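(* Let $k$ be a fixed positive integer. For every $n$ and every reduced Latin square $L$ of order $n$ that has two distinct rows or two distinct columns whose relative cycle structure contains at most $k$ cycles, $$|\mathfrak{A}(L)|\le n^2(n-1)^k.$$ Moreover, on the set of all such Latin squares $L$, the autotopy group $\mathfrak{A}(L)$ can be computed in time polynomial in $n$.
   Context: A Latin square of order $n$ is an $n\times n$ array with entries in $[n]=\{1,\dots,n\}$ such that each row and each column is a permutation of $[n]$. It is reduced if its first row and first column are both the identity permutation. Row $i$ of $L$ is viewed as the permutation $\sigma_i\in S_n$ with $\sigma_i(j)=L(i,j)$, and column $j$ as the permutation $\pi_j\in S_n$ with $\pi_j(i)=L(i,j)$. Permutations are composed as functions, right to left. An isotopism is a triple $(\alpha,\beta,\gamma)\in S_n^3$, acting on Latin squares of order $n$ by permuting rows by $\alpha$, columns by $\beta$ and symbols by $\gamma$: $L'=(\alpha,\beta,\gamma)(L)$ is given by $L'(\alpha(i),\beta(j))=\gamma(L(i,j))$. The autotopy group $\mathfrak{A}(L)$ is the group of isotopisms $\Theta$ with $\Theta(L)=L$. The cycle structure of a permutation is the partition of $n$ given by the lengths of the cycles in its disjoint cycle decomposition (cycles of length 1 included). The relative cycle structure of rows $r$ and $s$ is the cycle structure of $\sigma_s\sigma_r^{-1}$; similarly, the relative cycle structure of columns $r$ and $s$ is the cycle structure of $\pi_s\pi_r^{-1}$. ''Contains at most $k$ cycles'' means that this permutation has at most $k$ cycles, counting those of length 1. ''Computing $\mathfrak{A}(L)$'' means: given $L$ as input, output the list of all its autotopisms; polynomial in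 $n$ with $k$ fixed. *)

(* Defs.v *)
From HB Require Import structures.
From mathcomp Require Import all_boot all_order all_algebra all_fingroup.

Set Implicit Arguments.
Unset Strict Implicit.
Unset Printing Implicit Defensive.

(* The symbols, rows and columns {1, .., n} are numbered from 0, by 'I_n. *)
Record latin_square (n : nat) := LatinSquare {
  square :> 'M['I_n]_n;
  row_injective : forall i, injective (fun j => square i j);
  col_injective : forall j, injective (fun i => square i j)
}.

Definition reduced n (L : latin_square n) : Prop :=
  forall i : 'I_n, val i = 0 -> forall j, L i j = j /\ L j i = j.

Definition sigma n (L : latin_square n) (i : 'I_n) : 'S_n :=
  perm (@row_injective n L i).

Definition pi_ n (L : latin_square n) (j : 'I_n) : 'S_n :=
  perm (@col_injective n L j).

(* The product of {perm T} composes left to right, (s * t) x = t (s x), so the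
   right-to-left composite of sigma_r^-1 followed by sigma_s reads as below. *)
Definition row_relative n (L : latin_square n) (r s : 'I_n) : 'S_n :=
  ((sigma L r)^-1 * sigma L s)%g.

Definition col_relative n (L : latin_square n) (r s : 'I_n) : 'S_n :=
  ((pi_ L r)^-1 * pi_ L s)%g.

(* porbits includes the orbits of size 1. *)
Definition num_cycles n (p : 'S_n) : nat := #|porbits p|.

Definition has_few_cycles (k n : nat) (L : latin_square n) : Prop :=
  (exists r s : 'I_n, r != s /\ num_cycles (row_relative L r s) <= k) \/
  (exists r s : 'I_n, r != s /\ num_cycles (col_relative L r s) <= k).

Definition isotopism (n : nat) : finGroupType := ('S_n * 'S_n * 'S_n)%type.

Definition isotopism_act n (Theta : isotopism n) (M : 'M['I_n]_n) :
    'M['I_n]_n :=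
  let: (alpha, beta, gamma) := Theta in
  \matrix_(i, j) gamma (M ((alpha^-1)%g i) ((beta^-1)%g j)).

Lemma isotopism_actE n (alpha beta gamma : 'S_n) (M : 'M['I_n]_n) i j :
  isotopism_act (alpha, beta, gamma) M (alpha i) (beta j) = gamma (M i j).
Proof. by rewrite mxE !permK. Qed.

Definition autotopy n (L : latin_square n) : {set isotopism n} :=
  [set Theta | isotopism_act Theta L == L].

Lemma autotopy_group_set n (L : latin_square n) : group_set (autotopy L).
Proof.
apply/group_setP; split=> [|[[a b] c] [[a' b'] c']].
  by rewrite inE; apply/eqP/matrixP => i j; rewrite mxE !invg1 !perm1.
rewrite !inE => /eqP/matrixP fix1 /eqP/matrixP fix2.
apply/eqP/matrixP => i j; rewrite mxE !invMg !permM.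
rewrite -[RHS]fix2 mxE; congr (c' _).
by rewrite -[RHS]fix1 mxE.
Qed.

Canonical autotopy_group n (L : latin_square n) : {group isotopism n} :=
  Group (autotopy_group_set L).

(* A structured program over finitely many unbounded arrays of natural numbers,
   at unit cost per operation.  Addition and truncated subtraction are the only
   arithmetic: values then have at most linearly many bits in the running time
   (plus the size of the input), so polynomial time here coincides with
   polynomial time on Turing machines.  Unit-cost multiplication would break
   this. *)
Inductive expr :=
  | Const of nat
  | Cell of nat & expr    (* Cell a e is the cell of index e in array a *)
  | Add of expr & expr
  | Sub of expr & expr.

Inductive cmd :=
  | Skip
  | Store of nat & expr & expr    (* Store a e1 e2 is a[e1] := e2 *)
  | Seq of cmd & cmd
  | If of expr & cmd & cmd        (* a test succeeds when nonzero *)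
  | While of expr & cmd.

Definition memory := nat -> nat -> nat.

Definition update (m : memory) (a i v : nat) : memory :=
  fun b j => if (b == a) && (j == i) then v else m b j.

Fixpoint eval (m : memory) (e : expr) : nat :=
  match e with
  | Const c => c
  | Cell a e1 => m a (eval m e1)
  | Add e1 e2 => eval m e1 + eval m e2
  | Sub e1 e2 => eval m e1 - eval m e2
  end.

Fixpoint expr_cost (e : expr) : nat :=
  match e with
  | Const _ => 1
  | Cell _ e1 => (expr_cost e1).+1
  | Add e1 e2 | Sub e1 e2 => (expr_cost e1 + expr_cost e2).+1
  end.

(* exec c m t m' : run from memory m, c halts after time t in memory m'. *)
Inductive exec : cmd -> memory -> nat -> memory -> Prop :=
  | ExecSkip m : exec Skip m 1 m
  | ExecStore a e1 e2 m :
      exec (Store a e1 e2) m (expr_cost e1 + expr_cost e2).+1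
           (update m a (eval m e1) (eval m e2))
  | ExecSeq c1 c2 m1 m2 m3 t1 t2 :
      exec c1 m1 t1 m2 -> exec c2 m2 t2 m3 ->
      exec (Seq c1 c2) m1 (t1 + t2).+1 m3
  | ExecIfTrue e c1 c2 m m' t :
      eval m e != 0 -> exec c1 m t m' ->
      exec (If e c1 c2) m (expr_cost e + t).+1 m'
  | ExecIfFalse e c1 c2 m m' t :
      eval m e = 0 -> exec c2 m t m' ->
      exec (If e c1 c2) m (expr_cost e + t).+1 m'
  | ExecWhileTrue e c m1 m2 m3 t1 t2 :
      eval m1 e != 0 -> exec c m1 t1 m2 -> exec (While e c) m2 t2 m3 ->
      exec (While e c) m1 (expr_cost e + t1 + t2).+1 m3
  | ExecWhileFalse e c m :
      eval m e = 0 -> exec (While e c) m (expr_cost e).+1 m.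

Lemma exec_deterministic c m t1 m1 t2 m2 :
  exec c m t1 m1 -> exec c m t2 m2 -> t1 = t2 /\ m1 = m2.
Proof.
move=> H1; elim: H1 t2 m2 => {c m t1 m1} *;
  match goal with H : exec _ _ ?t ?m |- _ = ?t /\ _ = ?m => inversion H; subst end;
  repeat match goal with
  | IH : forall t m', exec ?c ?m t m' -> _, H : exec ?c ?m _ _ |- _ =>
      case: (IH _ _ H) => ? ?; subst; clear H
  | H : is_true (eval ?m ?e != 0), H' : eval ?m ?e = 0 |- _ =>
      by rewrite H' in H
  end; by [].
Qed.

(* The input is written at the start of array 0, all other cells being 0; the
   output is read at the start of array 1. *)
Definition input_memory (w : seq nat) : memory :=
  fun a i => if a == 0 then nth 0 w i else 0.

Definition has_output (m : memory) (w : seq nat) : Prop :=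
  forall i, i < size w -> m 1 i = nth 0 w i.

(* One program and one polynomial serve all sizes n and all instances x of size
   n in the domain; correct x relates x to its admissible outputs. *)
Definition computable_in_polynomial_time (X : nat -> Type)
    (domain : forall n, X n -> Prop)
    (encode : forall n, X n -> seq nat)
    (correct : forall n, X n -> seq nat -> Prop) : Prop :=
  exists (c : cmd) (p : {poly nat}),
    forall (n : nat) (x : X n), domain n x ->
      exists t m w, [/\ exec c (input_memory (encode n x)) t m,
                        t <= p.[n]%R, has_output m w & correct n x w].

(* n followed by the entries of the square, row by row. *)
Definition encode_square n (L : latin_square n) : seq nat :=
  n :: [seq val (L i j) | i <- enum 'I_n, j <- enum 'I_n].

Definition encode_perm n (s : 'S_n) : seq nat :=
  [seq val (s i) | i <- enum 'I_n].

Definition encode_isotopism n (Theta : isotopism n) : seq nat :=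
  let: (alpha, beta, gamma) := Theta in
  encode_perm alpha ++ encode_perm beta ++ encode_perm gamma.

(* The length of the list, followed by its members; as each of these occupies
   3n cells, the list can be read back. *)
Definition encode_isotopisms n (l : seq (isotopism n)) : seq nat :=
  size l :: flatten [seq encode_isotopism Theta | Theta <- l].

Definition lists_autotopisms n (L : latin_square n) (w : seq nat) : Prop :=
  exists l : seq (isotopism n),
    [/\ uniq l, l =i autotopy L & w = encode_isotopisms l].

(* Main.v *)
Require Import Defs.
From mathcomp Require Import all_boot all_order all_algebra all_fingroup.
From mathcomp Require Import zify.

(* Let p := sigma_s sigma_r^-1.  An autotopism (alpha, beta, gamma) conjugates p
   by gamma into sigma_b sigma_a^-1, where a := alpha r and b := alpha s.  Hence
   a, b and the values of gamma on one symbol x per cycle of p determine gamma,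
   then beta = sigma_a^-1 gamma sigma_r, then alpha.  There are n (n - 1)
   choices for (a, b), n for the image of the first symbol, and at most n - 1
   for each of the others, which must avoid that image.
   The algorithm runs through all the tuples (r, s, x_1, .., x_k) until one whose
   symbols meet all the cycles of p, then through all the tuples
   (a, b, y_1, .., y_k); each of them yields at most one autotopism, obtained by
   following the cycles of p and checked directly.  Columns are reduced to rows
   by transposition.  The program uses only loops bounded by n, so that it
   terminates in polynomial time whatever it computes. *)

Set Implicit Arguments.
Unset Strict Implicit.
Unset Printing Implicit Defensive.

(** * Loop programs *)

(* LFor i c runs c once for each value 0, .., n - 1 of the cell i[0], where n
   is the size of the instance, at index 0 of the input array. *)
Inductive lcmd :=
  | LSkip
  | LStore of nat & expr & expr
  | LSeq of lcmd & lcmd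
  | LIf of expr & lcmd & lcmd
  | LFor of nat & lcmd.

Definition var (a : nat) : expr := Cell a (Const 0).

Fixpoint compile (c : lcmd) : cmd :=
  match c with
  | LSkip => Skip
  | LStore a e1 e2 => Store a e1 e2
  | LSeq c1 c2 => Seq (compile c1) (compile c2)
  | LIf e c1 c2 => If e (compile c1) (compile c2)
  | LFor i c1 =>
      Seq (Store i (Const 0) (Const 0))
          (While (Defs.Sub (var 0) (var i))
             (Seq (compile c1) (Store i (Const 0) (Add (var i) (Const 1)))))
  end.

(** The number of rounds is fixed when the loop starts, whereas the compiled loop tests [n - i]
    afresh at each round; the two agree when the body writes neither the counter nor array 0. *)
Fixpoint run (c : lcmd) (m : memory) : memory :=
  match c with
  | LSkip => m
  | LStore a e1 e2 => update m a (eval m e1) (eval m e2)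
  | LSeq c1 c2 => run c2 (run c1 m)
  | LIf e c1 c2 => if eval m e != 0 then run c1 m else run c2 m
  | LFor i c1 =>
      iter (m 0 0) (fun m1 => update (run c1 m1) i 0 (run c1 m1 i 0 + 1))
           (update m i 0 0)
  end.

Fixpoint writes (c : lcmd) (a : nat) : bool :=
  match c with
  | LSkip => false
  | LStore b _ _ => a == b
  | LSeq c1 c2 | LIf _ c1 c2 => writes c1 a || writes c2 a
  | LFor i c1 => (a == i) || writes c1 a
  end.

Fixpoint well_formed (c : lcmd) : bool :=
  match c with
  | LSkip | LStore _ _ _ => true
  | LSeq c1 c2 | LIf _ c1 c2 => well_formed c1 && well_formed c2
  | LFor i c1 => ~~ writes c1 i && well_formed c1
  end.

(* 13 = 5 (guard) + 6 (increment) + 2 (Seq and While nodes). *)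
Fixpoint cost (c : lcmd) : {poly nat} :=
  (match c with
  | LSkip => 1
  | LStore _ e1 e2 => (expr_cost e1 + expr_cost e2).+1%:P
  | LSeq c1 c2 => cost c1 + cost c2 + 1
  | LIf e c1 c2 => (expr_cost e).+1%:P + cost c1 + cost c2
  | LFor _ c1 => 'X * (cost c1 + 13%:P) + 10%:P
  end)%R.

Lemma update_other m a i v b : b != a -> update m a i v b = m b.
Proof. by move=> nba; rewrite /update (negbTE nba). Qed.

Lemma update_same m a i v : update m a i v a i = v.
Proof. by rewrite /update !eqxx. Qed.

Lemma update_cell m a i v j : j != i -> update m a i v a j = m a j.
Proof. by move=> nji; rewrite /update (negbTE nji) andbF. Qed.

Lemma run_other c m a : ~~ writes c a -> run c m a = m a.
Proof.
elim: c m => [|b e1 e2|c1 IH1 c2 IH2|e c1 IH1 c2 IH2|i c IH] m //=.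
- exact: update_other.
- by rewrite negb_or => /andP[h1 h2]; rewrite IH2 // IH1.
- by rewrite negb_or => /andP[h1 h2]; case: ifP => _; [apply: IH1|apply: IH2].
- rewrite negb_or => /andP[h1 h2].
  elim: (m 0 0) => [|j IHj] /=; first exact: update_other.
  by rewrite update_other // IH.
Qed.

Section Loop.

Variables (i : nat) (c : lcmd).
Hypothesis ci : ~~ writes c i.

(** The step may assume that arrays the body never writes are as before the loop, so [Inv] has to
    describe only the arrays that change. *)
Lemma for_rule (m : memory) (Inv : nat -> memory -> Prop) :
    Inv 0 (update m i 0 0) ->
    (forall j m1, j < m 0 0 -> m1 i 0 = j ->
       (forall a, a != i -> ~~ writes c a -> m1 a = m a) ->
       Inv j m1 -> Inv j.+1 (update (run c m1) i 0 j.+1)) ->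
  Inv (m 0 0) (run (LFor i c) m).
Proof.
move=> Inv0 InvS /=.
set step := fun m1 : memory => _.
suff H j : j <= m 0 0 -> [/\ iter j step (update m i 0 0) i 0 = j,
   (forall a, a != i -> ~~ writes c a -> iter j step (update m i 0 0) a = m a)
   & Inv j (iter j step (update m i 0 0))] by case: (H _ (leqnn _)).
elim: j => [|j IHj] ltj.
  by split=> [|a ai _|] /=; rewrite ?update_same ?update_other.
have [e1 e2 e3] := IHj (ltnW ltj).
rewrite iterS; set mj := iter j _ _ in e1 e2 e3 *.
have step_j : step mj = update (run c mj) i 0 j.+1.
  by rewrite /step (run_other _ ci) e1 addn1.
rewrite step_j; split; first exact: update_same.
- by move=> a ai wa; rewrite update_other // run_other // e2.
- exact: InvS.
Qed.

Lemma exec_for (p : nat) (m : memory) : i != 0 -> ~~ writes c 0 ->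
    (forall m1, m1 0 0 = m 0 0 ->
       exists2 t, exec (compile c) m1 t (run c m1) & t <= p) ->
  exists2 t, exec (compile (LFor i c)) m t (run (LFor i c) m)
    & t <= m 0 0 * (p + 13) + 10.
Proof.
move=> i0 c0 exc /=.
set step := fun m1 : memory => _.
set body := Seq (compile c) _; set guard := Defs.Sub _ _.
(* Here [j] counts the rounds left and 6 is the cost of the last, failing guard; the initial store
   (3) and the outer [Seq] (1) bring it to 10. *)
suff H j m1 : m1 0 0 = m 0 0 -> m1 i 0 + j = m 0 0 ->
    exists2 t, exec (While guard body) m1 t (iter j step m1)
      & t <= j * (p + 13) + 6.
  have [||t ex le_t] := H (m 0 0) (update m i 0 0).
  - by rewrite update_other // eq_sym.
  - by rewrite update_same.
  exists (3 + t).+1; last by lia.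
  by apply: ExecSeq ex; apply: ExecStore.
elim: j m1 => [|j IHj] m1 m1n; rewrite ?addn0 => eij.
  by exists 6 => //; apply: ExecWhileFalse; rewrite /= m1n eij subnn.
have [t1 ex1 le1] := exc _ m1n.
have [||t2 ex2 le2] := IHj (step m1).
- by rewrite /step update_other ?run_other // eq_sym.
- by rewrite /step update_same run_other // addn1 addSnnS.
exists (5 + (t1 + 6).+1 + t2).+1; last by rewrite mulSn; lia.
rewrite iterSr; apply: ExecWhileTrue ex2.
  by rewrite /= m1n -eij; lia.
by apply: ExecSeq ex1 _; apply: ExecStore.
Qed.

End Loop.

(** Every subprogram is charged at the same size, since array 0 is never written; a test is charged
    for both branches, which avoids a maximum of polynomials. *)
Lemma exec_run c m : well_formed c -> ~~ writes c 0 ->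
  exists2 t, exec (compile c) m t (run c m) & t <= (cost c).[m 0 0]%R.
Proof.
elim: c m => [|b e1 e2|c1 IH1 c2 IH2|e c1 IH1 c2 IH2|i c IH] m /=.
- by exists 1; [apply: ExecSkip | rewrite hornerC].
- by move=> _ _; exists (expr_cost e1 + expr_cost e2).+1;
    [apply: ExecStore | rewrite hornerC].
- rewrite negb_or => /andP[wf1 wf2] /andP[n1 n2].
  have [t1 ex1 le1] := IH1 m wf1 n1.
  have [t2 ex2 le2] := IH2 (run c1 m) wf2 n2.
  rewrite run_other // in le2.
  exists (t1 + t2).+1; first exact: ExecSeq ex1 ex2.
  by rewrite !hornerD hornerC; lia.
- rewrite negb_or => /andP[wf1 wf2] /andP[n1 n2].
  have [t1 ex1 le1] := IH1 m wf1 n1.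
  have [t2 ex2 le2] := IH2 m wf2 n2.
  rewrite !hornerD hornerC; have [e0|e0] := eqVneq.
    by exists (expr_cost e + t2).+1; [apply: ExecIfFalse | lia].
  by exists (expr_cost e + t1).+1; [apply: ExecIfTrue | lia].
- rewrite negb_or => /andP[ci wf] /andP[i0 c0]; rewrite eq_sym in i0.
  rewrite hornerD hornerM hornerX hornerD !hornerC.
  by apply: exec_for => // m1 <-; apply: IH.
Qed.

(** * Autotopisms and seeds *)

Lemma transpose_row_injective n (L : latin_square n) i :
  injective (fun j => (trmx L) i j).
Proof. by move=> j j'; rewrite !mxE => /col_injective. Qed.

Lemma transpose_col_injective n (L : latin_square n) j :
  injective (fun i => (trmx L) i j).
Proof. by move=> i i'; rewrite !mxE => /row_injective. Qed.

Definition transpose n (L : latin_square n) : latin_square n :=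
  LatinSquare (transpose_row_injective (L := L)) (transpose_col_injective (L := L)).

Definition swap n (Theta : isotopism n) : isotopism n :=
  (Theta.1.2, Theta.1.1, Theta.2).

Lemma swapK n : involutive (@swap n).
Proof. by case=> [[]]. Qed.

Lemma autotopyP n (L : latin_square n) (Theta : isotopism n) :
  reflect (forall i j, L (Theta.1.1 i) (Theta.1.2 j) = Theta.2 (L i j))
          (Theta \in autotopy L).
Proof.
case: Theta => [[a b] c]; rewrite inE; apply: (iffP eqP) => /= [fixL i j|hL].
  by have := isotopism_actE a b c L i j; rewrite [isotopism_act _ _]fixL.
by apply/matrixP => i j; rewrite mxE -hL !permKV.
Qed.

Lemma autotopy_transpose n (L : latin_square n) (Theta : isotopism n) :
  (swap Theta \in autotopy (transpose L)) = (Theta \in autotopy L).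
Proof.
by apply/autotopyP/autotopyP => h i j; have := h j i; rewrite /= !mxE.
Qed.

Lemma card_autotopy_transpose n (L : latin_square n) :
  #|autotopy (transpose L)| = #|autotopy L|.
Proof.
rewrite -(card_imset (mem (autotopy L)) (inv_inj (@swapK n))).
apply: eq_card => Theta; rewrite -[Theta in LHS]swapK autotopy_transpose.
by rewrite -[Theta in RHS]swapK mem_imset //; apply: inv_inj (@swapK n).
Qed.

Lemma row_relative_transpose n (L : latin_square n) (r s : 'I_n) :
  row_relative (transpose L) r s = col_relative L r s.
Proof.
rewrite /row_relative /col_relative.
by congr (_^-1 * _)%g; apply/permP => i; rewrite !permE /= mxE.
Qed.

(** * An autotopism is determined by the image of a generating seed *)

Section Determination.

Variables (n : nat) (L : latin_square n).
Implicit Types (Theta : isotopism n) (r s : 'I_n).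

Lemma row_relativeE r s j : row_relative L r s (L r j) = L s j.
Proof.
have e t : sigma L t j = L t j by rewrite permE.
by rewrite permM -e permK e.
Qed.

Lemma row_onto r w : exists j, w = L r j.
Proof.
by exists ((sigma L r)^-1%g w); rewrite -[LHS](permKV (sigma L r)) permE.
Qed.

(** Each symbol is some [L r j], which the relative permutation sends to [L s j]; gamma carries both
    entries to column beta j, in rows alpha r and alpha s. *)
Lemma row_relative_autotopy Theta r s w : Theta \in autotopy L ->
  row_relative L (Theta.1.1 r) (Theta.1.1 s) (Theta.2 w) =
  Theta.2 (row_relative L r s w).
Proof.
move/autotopyP=> h; have [j ->] := row_onto r w.
by rewrite -h !row_relativeE h.
Qed.

Lemma iter_row_relative_autotopy Theta r s w t : Theta \in autotopy L ->
  iter t (row_relative L (Theta.1.1 r) (Theta.1.1 s)) (Theta.2 w) =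
  Theta.2 (iter t (row_relative L r s) w).
Proof.
by move=> h; elim: t => //= t ->; rewrite row_relative_autotopy.
Qed.

Definition reached r s (xs : seq 'I_n) (w : 'I_n) :=
  has (fun x => w \in porbit (row_relative L r s) x) xs.

(* A seed x0 :: x1 :: xs consists of two rows x0, x1 and of the symbols xs. *)
Definition generating (x0 x1 : 'I_n) xs := forall w, reached x0 x1 xs w.

Definition seed_image Theta (r s : 'I_n) (xs : seq 'I_n) : seq 'I_n :=
  [:: Theta.1.1 r, Theta.1.1 s & map Theta.2 xs].

Lemma seed_image_inj r s xs : generating r s xs ->
  {in autotopy L &, injective (fun Theta => seed_image Theta r s xs)}.
Proof.
move=> gen [[a b] c] [[a' b'] c'] hT hT' /= [/= ear eas /eq_in_map ec].
have eqc : c = c'.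
  apply/permP => w; have /hasP[x xxs /porbitP[t ->]] := gen w.
  rewrite permX -(iter_row_relative_autotopy r s x t hT).
  by rewrite -(iter_row_relative_autotopy r s x t hT') /= ear eas ec.
have eqb : b = b'.
  apply/permP => j; apply: (@row_injective _ L (a r)).
  by move/autotopyP: hT => /= ->; rewrite ear; move/autotopyP: hT' => /= ->;
    rewrite eqc.
suff -> : a = a' by rewrite eqb eqc.
(* Here [r] serves as an arbitrary column index. *)
apply/permP => i; apply: (@col_injective _ L (b r)).
move/autotopyP: hT => /= ->; rewrite eqb.
by move/autotopyP: hT' => /= ->; rewrite eqc.
Qed.

Lemma cycle_representatives r s : exists xs : seq 'I_n,
  [/\ uniq xs, size xs = num_cycles (row_relative L r s) & generating r s xs].
Proof.
set p := row_relative L r s.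
(* The default [r] is never taken on a cycle of [p]; the choice is injective because a symbol
   determines its cycle. *)
pose rep (O : {set 'I_n}) := odflt r [pick x | O == porbit p x].
have repK O : O \in porbits p -> porbit p (rep O) = O.
  case/imsetP => x _ ->; rewrite /rep; case: pickP => [y /eqP //|/(_ x)].
  by rewrite eqxx.
exists (map rep (enum (porbits p))); split; last 2 first.
- by rewrite size_map -cardE.
- move=> w; apply/hasP; exists (rep (porbit p w)).
    by apply: map_f; rewrite mem_enum; apply: imset_f.
  by rewrite repK ?porbit_id // imset_f.
rewrite map_inj_in_uniq ?enum_uniq // => O O'; rewrite !mem_enum => hO hO' e.
by rewrite -(repK _ hO) -(repK _ hO') e.
Qed.

End Determination.

(* Two rows differ and the symbols of xs are distinct, so all the coordinates
   of a seed image but two avoid a value that is already known. *)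
Lemma card_autotopy_seed n (L : latin_square n) r s x xs : r != s -> uniq (x :: xs) ->
  generating L r s (x :: xs) ->
  #|autotopy L| <= n * (n - 1) * n * (n - 1) ^ size xs.
Proof.
move=> rs /= /andP[xxs _] gen.
(* Sizes 0 and 1 have no two distinct rows. *)
case: n L r s x xs rs xxs gen => [|[|n']] M r s x xs rs xxs gen; first by case: r {rs xxs gen}.
  by move: rs; rewrite [r]ord1 [s]ord1.
(* [code a b] is the rank of [b] among the n - 1 values other than [a]; the default is reached only
   for [b = a]. *)
pose code (a b : 'I_n'.+2) := odflt ord0 (unlift a b) : 'I_n'.+1.
have codeK a b : b != a -> lift a (code a b) = b.
  by rewrite /code eq_sym; case/unlift_some => j -> ->.
pose f (Theta : isotopism n'.+2) :=
  (Theta.1.1 r, code (Theta.1.1 r) (Theta.1.1 s), Theta.2 x,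
   [tuple of map (fun y => code (Theta.2 x) (Theta.2 y)) (in_tuple xs)]).
have injf : {in autotopy M &, injective f}.
  move=> T T' hT hT' [er es ex exs]; apply: (seed_image_inj gen) => //.
  rewrite /seed_image /= -er -ex; congr [:: _, _, _ & _].
    rewrite -(codeK (T.1.1 r) (T.1.1 s)) ?(inj_eq perm_inj) 1?eq_sym //.
    by rewrite es er codeK // (inj_eq perm_inj) eq_sym.
  apply/eq_in_map => y yxs; have yx : y != x by apply: contraNneq xxs => <-.
  rewrite -(codeK (T.2 x) (T.2 y)) ?(inj_eq perm_inj) //.
  by move/eq_in_map: exs => /(_ _ yxs) ->; rewrite ex codeK // (inj_eq perm_inj).
rewrite -(card_in_imset injf); apply: leq_trans (max_card _) _.
by rewrite !card_prod card_tuple !card_ord subn1.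
Qed.

(** With c cycles, the two rows contribute n (n - 1), the first symbol n and the c - 1 others (n -
    1)^(c - 1), hence n^2 (n - 1)^c in all. *)
Lemma card_autotopy_rows k n (L : latin_square n) r s :
    r != s -> num_cycles (row_relative L r s) <= k ->
  #|autotopy L| <= n ^ 2 * (n - 1) ^ k.
Proof.
move=> rs; have [[|x xs] [uxs <- gen]] := cycle_representatives L r s.
  by have := gen r.
move=> lek; apply: leq_trans (card_autotopy_seed rs uxs gen) _.
(* The base [n - 1] must be positive for the exponent to grow up to [k]. *)
have n2 : 1 < n.
  rewrite ltnNge; apply: contra rs => n1; apply/eqP/val_inj => /=.
  by have := ltn_ord r; have := ltn_ord s; lia.
have -> : n * (n - 1) * n * (n - 1) ^ size xs = n ^ 2 * (n - 1) ^ size (x :: xs).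
  by rewrite -mulnn /= expnS -!mulnA; congr (_ * _); rewrite mulnCA.
by rewrite leq_mul2l leq_pexp2l ?orbT //; lia.
Qed.

Theorem card_autotopy_few_cycles k n (L : latin_square n) :
  has_few_cycles k L -> #|autotopy L| <= n ^ 2 * (n - 1) ^ k.
Proof.
case=> -[r [s [rs lek]]]; first exact: card_autotopy_rows lek.
rewrite -card_autotopy_transpose; apply: card_autotopy_rows rs _.
by rewrite row_relative_transpose.
Qed.

(** * Building blocks of the program *)

(* Arrays: 0 input, 1 output, 2 offsets of the rows in a table, 3 transposed
   table, 4 first free cell of the output, 5 flag set once a seed is found,
   6, 7, 8 images of rows, columns and symbols, 9 and 10 the permutations p of
   the seed and q of its image, 11 flag of a valid candidate, 12 and 13 loop
   counters, 14 and 15 current position in walk, 16 inverse of a permutation,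
   20 + 2l and 21 + 2l the l-th coordinate of the seed and of its image. *)
Definition block : seq lcmd -> lcmd := foldr LSeq LSkip.

Lemma writes_block cs a : writes (block cs) a = has (fun c => writes c a) cs.
Proof. by elim: cs => //= c cs ->. Qed.

Lemma well_formed_block cs : well_formed (block cs) = all well_formed cs.
Proof. by elim: cs => //= c cs ->. Qed.

Lemma run_block_cat cs cs' m : run (block (cs ++ cs')) m = run (block cs') (run (block cs) m).
Proof. by elim: cs m => //= c cs IH m; rewrite IH. Qed.

(** Row offsets stored in array 2 replace the product of [e1] by n, as the machine has no
    multiplication; they serve for the square and for its transpose. *)
Definition entry (tab : nat) (e1 e2 : expr) : expr := Cell tab (Add (Cell 2 e1) e2).

(** Subtraction being truncated, this is the absolute difference. *)
Definition differ (e1 e2 : expr) : expr := Add (Defs.Sub e1 e2) (Defs.Sub e2 e1).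

Lemma differ_eq0 m e1 e2 : (eval m (differ e1 e2) == 0) = (eval m e1 == eval m e2).
Proof. by rewrite /= addn_eq0 !subn_eq0 -eqn_leq. Qed.

Definition table_in (tab n : nat) (M : 'M['I_n]_n) (m : memory) : Prop :=
  m 0 0 = n /\ forall i j : 'I_n, m tab (m 2 i + j) = M i j.

Lemma table_in_eq tab n (M : 'M['I_n]_n) m m' :
  m' 0 = m 0 -> m' 2 = m 2 -> m' tab = m tab -> table_in tab M m -> table_in tab M m'.
Proof. by rewrite /table_in => -> -> ->. Qed.

Section Fill.

Variables (n i a : nat) (e1 e2 : expr) (m : memory) (f g : 'I_n -> nat).

(** Injectivity of [f] keeps later rounds from overwriting a cell. Taking for [f] a row or a column
    of the square, and for [g] the index, tabulates an inverse. *)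
Lemma run_fill : a != i -> m 0 0 = n ->
    (forall (j : 'I_n) (m1 : memory), m1 i 0 = j ->
       (forall b, b != i -> b != a -> m1 b = m b) ->
       eval m1 e1 = f j /\ eval m1 e2 = g j) ->
    injective f ->
  forall j, run (LFor i (LStore a e1 e2)) m a (f j) = g j.
Proof.
move=> ai mn he injf.
have := @for_rule i (LStore a e1 e2) _ m
  (fun t m1 => forall l : 'I_n, l < t -> m1 a (f l) = g l).
rewrite mn => H j; apply: H; rewrite ?ltn_ord //= 1?eq_sym //.
move=> t m1 ltn e_t same IH l; rewrite ltnS leq_eqVlt update_other //.
have [-> ->] := he (Ordinal ltn) m1 e_t same.
case/orP => [/eqP elt|ltl].
  have -> : l = Ordinal ltn by apply: val_inj.
  by rewrite update_same.
rewrite update_cell ?IH // (inj_eq injf) -val_eqE /=; lia.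
Qed.

End Fill.

(** A test passes when [e] vanishes, and a failure lowers the flag for good, so that successive
    checks compute a conjunction. *)
Definition check (e : expr) : lcmd := LIf e (LStore 11 (Const 0) (Const 0)) LSkip.

Lemma run_check e m :
  (run (check e) m 11 0 != 0) = (m 11 0 != 0) && (eval m e == 0).
Proof.
rewrite [run _ _]/=; case: (eval m e =P 0) => _; first by rewrite andbT.
by rewrite andbF.
Qed.

Lemma run_test_for i c n m (phi : 'I_n -> bool) :
    i != 11 -> ~~ writes c i -> m 0 0 = n ->
    (forall (j : 'I_n) (m1 : memory), m1 i 0 = j ->
       (forall b, b != i -> ~~ writes c b -> m1 b = m b) ->
       (run c m1 11 0 != 0) = (m1 11 0 != 0) && phi j) ->
  (run (LFor i c) m 11 0 != 0) = (m 11 0 != 0) && [forall j, phi j].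
Proof.
rewrite eq_sym => i11 ci mn hc.
have := @for_rule i c ci m (fun t m1 => (m1 11 0 != 0) =
  (m 11 0 != 0) && [forall j : 'I_n, (j < t) ==> phi j]).
rewrite mn => H; rewrite {}H.
- by congr andb; apply: eq_forallb => j; rewrite ltn_ord.
- rewrite update_other //.
  by rewrite (_ : [forall j, _]) ?andbT //; apply/forallP.
move=> t m1 ltn e_t same IH.
rewrite update_other // (hc (Ordinal ltn)) // IH -andbA; congr andb.
apply/andP/forallP => [[/forallP h1 h2] j|h].
  rewrite ltnS leq_eqVlt; apply/implyP => /orP[/eqP ej|].
    by have -> : j = Ordinal ltn by apply: val_inj.
  exact/implyP/h1.
split; last by have := h (Ordinal ltn); rewrite /= ltnS leqnn.
by apply/forallP => j; apply/implyP => lt; have := h j; rewrite ltnS (ltnW lt).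
Qed.

(** Only the flag and the loop counters, arrays 11 to 13, may change; thus [phi] can refer to the
    memory [m] that precedes a whole sequence of tests. *)
Definition tests (m : memory) (c : lcmd) (phi : bool) : Prop :=
  (forall a, writes c a -> 10 < a < 14) /\
  forall m1, (forall a, ~~ (10 < a < 14) -> m1 a = m a) ->
    (run c m1 11 0 != 0) = (m1 11 0 != 0) && phi.

Lemma tests_skip m : tests m LSkip true.
Proof. by split=> // m1 _; rewrite andbT. Qed.

Lemma tests_seq m c1 c2 phi1 phi2 : tests m c1 phi1 -> tests m c2 phi2 ->
  tests m (LSeq c1 c2) (phi1 && phi2).
Proof.
move=> [w1 t1] [w2 t2]; split=> [a /orP[/w1|/w2] //|m1 same /=].
rewrite t2 ?t1 ?andbA // => a na; rewrite run_other ?same //.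
by apply: contra na; apply: w1.
Qed.

Lemma tests_check m e phi :
  (forall m1, (forall a, ~~ (10 < a < 14) -> m1 a = m a) ->
     (eval m1 e == 0) = phi) ->
  tests m (check e) phi.
Proof.
move=> he; split=> [a /=|m1 same]; first by rewrite orbF => /eqP->.
by rewrite run_check he.
Qed.

Lemma tests_for n m e (phi : 'I_n -> bool) : m 0 0 = n ->
    (forall (j : 'I_n) (m1 : memory), m1 12 0 = j -> (forall a, ~~ (10 < a < 14) -> m1 a = m a) ->
       (eval m1 e == 0) = phi j) ->
  tests m (LFor 12 (check e)) [forall j, phi j].
Proof.
move=> mn he; split=> [a /=|m1 same]; first by rewrite orbF => /orP[] /eqP->.
apply: run_test_for => // [|j m2 e_j same2]; first by rewrite same.
rewrite run_check (he j) // => a na.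
by rewrite same2 /= ?orbF ?same //; lia.
Qed.

Lemma tests_for2 n m e (phi : 'I_n -> 'I_n -> bool) : m 0 0 = n ->
    (forall (i j : 'I_n) (m1 : memory), m1 12 0 = i -> m1 13 0 = j ->
       (forall a, ~~ (10 < a < 14) -> m1 a = m a) ->
       (eval m1 e == 0) = phi i j) ->
  tests m (LFor 12 (LFor 13 (check e))) [forall i, forall j, phi i j].
Proof.
move=> mn he; split=> [a /=|m1 same].
  by rewrite orbF => /orP[|/orP[]] /eqP->.
apply: (run_test_for (phi := fun i => [forall j, phi i j])) => // [|i m2 e_i same2].
  by rewrite same.
apply: run_test_for => // [|j m3 e_j same3].
  by rewrite same2 ?same.
rewrite run_check (he i j) // => [|a na]; first by rewrite same3.
by rewrite same3 ?same2 ?same //=; lia.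
Qed.

(** * Following the cycles of the relative permutations *)

Definition seed_var (l : nat) := 20 + l.*2.
Definition image_var (l : nat) := 21 + l.*2.

Definition holds (m : memory) (f : nat -> nat) (s : seq nat) : Prop :=
  forall l, l < size s -> m (f l) 0 = nth 0 s l.

(* Sets gamma (p^t x) := q^t y for all t < n. *)
Definition walk (x y : nat) : lcmd := block
  [:: LStore 14 (Const 0) (var x); LStore 15 (Const 0) (var y);
      LFor 12 (block [:: LStore 8 (var 14) (var 15);
                         LStore 14 (Const 0) (Cell 9 (var 14));
                         LStore 15 (Const 0) (Cell 10 (var 15))])].

(** A cycle has length at most n, so n steps exhaust it. *)
Lemma traject_porbit (n : nat) (p : 'S_n) (x : 'I_n) :
  traject p x n =i porbit p x.
Proof.
move=> w; apply/trajectP/idP => [[t _ ->]|].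
  by rewrite -permX mem_porbit.
rewrite porbit_traject => /trajectP[t lt ->]; exists t => //.
by apply: leq_trans lt _; rewrite -[X in _ <= X]card_ord; apply: max_card.
Qed.

(** Since q c = c p, cell 15 holds throughout the image under [c] of the symbol in cell 14. [G]
    collects the symbols already treated; the others still carry the invalid value n. *)
Lemma run_walk n (p q c : 'S_n) (xv yv : nat) (x : 'I_n) (G : pred 'I_n) m :
    19 < xv -> 19 < yv -> m 0 0 = n -> (forall w : 'I_n, m 9 w = p w) ->
    (forall w : 'I_n, m 10 w = q w) ->
    (forall w, q (c w) = c (p w)) -> m xv 0 = x -> m yv 0 = c x ->
    (forall w : 'I_n, m 8 w = if G w then val (c w) else n) ->
  forall w : 'I_n, run (walk xv yv) m 8 w =
    if (w \in porbit p x) || G w then val (c w) else n.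
Proof.
move=> gx gy mn mP mQ cpq mx my mC.
rewrite /walk; set step := block [:: LStore 8 (var 14) (var 15); _; _] => w.
set m1 := update (update m 14 0 x) 15 0 (c x).
have -> : run (block [:: LStore 14 (Const 0) (var xv); LStore 15 (Const 0) (var yv);
      LFor 12 step]) m = run (LFor 12 step) m1; last move: w.
  rewrite -[LHS]/(run (LFor 12 step)
    (update (update m 14 0 (m xv 0)) 15 0 (update m 14 0 (m xv 0) yv 0))).
  by rewrite (update_other _ _ _ (_ : yv != 14)) ?mx ?my //; lia.
have m1n : m1 0 0 = n by [].
have := @for_rule 12 step isT m1 (fun t m2 => [/\ m2 14 0 = iter t p x, m2 15 0 = c (iter t p x)
   & forall w : 'I_n, m2 8 w = if (w \in traject p x t) || G w then val (c w) else n]).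
rewrite m1n => H; have {H} [||_ _ H w] := H; last by rewrite H traject_porbit.
- by split=> // w; rewrite update_other // mC.
- move=> t m2 ltn e_t same [e14 e15 e8].
  have e9 : m2 9 = m 9 by rewrite same.
  have e10 : m2 10 = m 10 by rewrite same.
  split.
  + by change (m2 9 (m2 14 0) = p (iter t p x)); rewrite e9 e14 mP.
  + by change (m2 10 (m2 15 0) = c (p (iter t p x))); rewrite e10 e15 mQ cpq.
  + move=> w; change (update m2 8 (m2 14 0) (m2 15 0) 8 w =
      if (w \in traject p x t.+1) || G w then val (c w) else n).
    rewrite e14 e15 trajectSr mem_rcons inE -orbA.
    have [->|neq] := eqVneq w (iter t p x); first by rewrite update_same.
    by rewrite update_cell // e8.
Qed.

(** * The candidate autotopism of a seed and its image *)

Section Candidate.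

Variables (tab : nat) (f : nat -> nat).

(* Initialising gamma with the invalid symbol n makes the checks fail on every
   seed that misses a cycle; in particular they accept the identity image of
   exactly the generating seeds. *)
Definition setup : lcmd := block
  [:: LFor 12 (LStore 8 (var 12) (var 0));
      LFor 12 (LStore 9 (entry tab (var (seed_var 0)) (var 12))
                        (entry tab (var (seed_var 1)) (var 12)));
      LFor 12 (LStore 10 (entry tab (var (f 0)) (var 12))
                         (entry tab (var (f 1)) (var 12)))].

Definition walks (k : nat) : lcmd :=
  block [seq walk (seed_var l.+2) (f l.+2) | l <- iota 0 k].

(** Array 16 holds in turn the inverses of row alpha r, of column beta 0 and of gamma. The first
    locates gamma (L r j), which gives beta j; the second locates gamma (L i 0), which gives alpha
    i; the third serves to test that gamma is injective. *)
Definition complete : lcmd := block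
  [:: LFor 12 (LStore 16 (entry tab (var (f 0)) (var 12)) (var 12));
      LFor 12 (LStore 7 (var 12)
                 (Cell 16 (Cell 8 (entry tab (var (seed_var 0)) (var 12)))));
      LFor 12 (LStore 16 (entry tab (var 12) (Cell 7 (Const 0))) (var 12));
      LFor 12 (LStore 6 (var 12) (Cell 16 (Cell 8 (entry tab (var 12) (Const 0)))));
      LFor 12 (LStore 16 (Cell 8 (var 12)) (var 12))].

Definition below (a : nat) : expr := Defs.Sub (Add (Cell a (var 12)) (Const 1)) (var 0).

(** Only gamma is tested for injectivity: that of alpha and beta follows from the compatibility with
    the table. The last checks force the candidate to have the prescribed image. *)
Definition checks (k : nat) : lcmd := block
  ([:: LFor 12 (check (below 6)); LFor 12 (check (below 7)); LFor 12 (check (below 8));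
       LFor 12 (check (differ (Cell 16 (Cell 8 (var 12))) (var 12)));
       LFor 12 (LFor 13 (check
         (differ (entry tab (Cell 6 (var 12)) (Cell 7 (var 13)))
                 (Cell 8 (entry tab (var 12) (var 13))))));
       check (differ (Cell 6 (var (seed_var 0))) (var (f 0)));
       check (differ (Cell 6 (var (seed_var 1))) (var (f 1)))]
   ++ [seq check (differ (Cell 8 (var (seed_var l.+2))) (var (f l.+2))) | l <- iota 0 k]).

(** With [f := image_var] this looks for an autotopism with a given image; with [f := seed_var] it
    decides whether the seed meets all the cycles. *)
Definition candidate (k : nat) : lcmd := block
  [:: setup; walks k; complete; LStore 11 (Const 0) (Const 1); checks k].

Hypotheses (tab_lt : tab < 4) (f_gt : forall l, 19 < f l).

Lemma seed_var_gt l : 19 < seed_var l.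
Proof. by rewrite /seed_var; lia. Qed.

Lemma writes_setup a : writes setup a -> 5 < a < 20.
Proof. by rewrite /=; lia. Qed.

Lemma writes_walks k a : writes (walks k) a -> 5 < a < 20.
Proof.
by rewrite writes_block has_map => /hasP[l _] /=; lia.
Qed.

Lemma writes_complete a : writes complete a -> 5 < a < 20.
Proof. by rewrite /=; lia. Qed.

Lemma run_same c m a : (forall b, writes c b -> 5 < b < 20) -> ~~ (5 < a < 20) ->
  run c m a = m a.
Proof. by move=> wc na; apply: run_other; apply: contra na; apply: wc. Qed.

Section Instance.

Variables (n : nat) (M : latin_square n) (r s : 'I_n) (xs : seq 'I_n).

Notation seed_in := (fun m : memory => holds m seed_var (map val [:: r, s & xs])).

Lemma tests_checks (m : memory) : table_in tab M m -> seed_in m ->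
  tests m (checks (size xs))
    [&& [forall i : 'I_n, m 6 i < n], [forall i : 'I_n, m 7 i < n],
        [forall i : 'I_n, m 8 i < n], [forall i : 'I_n, m 16 (m 8 i) == i],
        [forall i : 'I_n, forall j : 'I_n, m tab (m 2 (m 6 i) + m 7 j) == m 8 (M i j)],
        m 6 r == m (f 0) 0, m 6 s == m (f 1) 0
      & [forall l : 'I_(size xs), m 8 (nth r xs l) == m (f l.+2) 0]].
Proof.
move=> [mn mM] seedm.
have tabn : ~~ (10 < tab < 14) by lia.
have fn l : ~~ (10 < f l < 14) by have := f_gt l; lia.
have sn l : ~~ (10 < seed_var l < 14) by have := seed_var_gt l; lia.
have er : m (seed_var 0) 0 = r by apply: seedm 0 _.
have es : m (seed_var 1) 0 = s by apply: seedm 1 _.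
have below_test a : ~~ (10 < a < 14) ->
    tests m (LFor 12 (check (below a))) [forall i : 'I_n, m a i < n].
  move=> na; apply: tests_for => // j m1 ej same.
  by rewrite /= ej !same // mn addn1 subn_eq0.
rewrite /checks /block /=; do !apply: tests_seq; try exact: below_test.
- by apply: tests_for => // j m1 ej same; rewrite differ_eq0 /= ej !same.
- apply: tests_for2 => // i j m1 ei ej same.
  by rewrite differ_eq0 /= ei ej !same // mM.
- by apply: tests_check => m1 same; rewrite differ_eq0 /= !same // er.
- by apply: tests_check => m1 same; rewrite differ_eq0 /= !same // es.
have -> : [forall l : 'I_(size xs), m 8 (nth r xs l) == m (f l.+2) 0] =
    all (fun l => m 8 (nth r xs l) == m (f l.+2) 0) (iota 0 (size xs)).
  apply/forallP/allP => [h l|h l]; last by apply: h; rewrite mem_iota /=.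
  by rewrite mem_iota => /andP[_ lt]; apply: (h (Ordinal lt)).
have sub l : l \in iota 0 (size xs) -> m (seed_var l.+2) 0 = nth r xs l.
  rewrite mem_iota => /andP[_ lt]; rewrite seedm /= ?size_map //.
  exact: nth_map.
elim: (iota _ _) sub => [|l ls IH] sub /=; first exact: tests_skip.
apply: tests_seq; last by apply: IH => l' hl'; apply: sub; rewrite inE hl' orbT.
by apply: tests_check => m1 same; rewrite differ_eq0 /= !same // sub ?mem_head.
Qed.

Lemma writes_checks k a : writes (checks k) a -> 10 < a < 14.
Proof.
rewrite writes_block has_cat has_map => /orP[/=|/hasP[l _] /=]; lia.
Qed.

Lemma writes_candidate k a : writes (candidate k) a -> 5 < a < 20.
Proof.
rewrite /candidate -[writes _ a]/[|| _, _, _, _, _ | _].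
case/or4P => [/writes_setup|/writes_walks|/writes_complete|] //.
by rewrite orbF /= => /orP[/eqP->|/writes_checks] //; lia.
Qed.


Definition candidate_prefix (k : nat) : lcmd :=
  block [:: setup; walks k; complete; LStore 11 (Const 0) (Const 1)].

Lemma candidateE k m : run (candidate k) m = run (checks k) (run (candidate_prefix k) m).
Proof. by []. Qed.

Lemma writes_candidate_prefix k a : writes (candidate_prefix k) a -> 5 < a < 20.
Proof.
rewrite /candidate_prefix -[writes _ a]/[|| _, _, _, _ | _].
by case/or4P => [/writes_setup|/writes_walks|/writes_complete|] //; rewrite orbF => /eqP->.
Qed.

Lemma table_in_run c m : (forall a, writes c a -> 5 < a < 20) ->
  table_in tab M m -> table_in tab M (run c m).
Proof. by move=> wc; apply: table_in_eq; apply: run_same wc _ => //; lia. Qed.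

Lemma holds_run c m g l : (forall a, writes c a -> 5 < a < 20) ->
  (forall l, 19 < g l) -> holds m g l -> holds (run c m) g l.
Proof.
move=> wc hg h j lt; rewrite (run_same _ wc) ?h //.
by rewrite negb_and -!leqNgt hg orbT.
Qed.

(** The tests preserve the arrays they read, so their outcome can be stated on the final memory; the
    table and the coordinates are still those of [m]. *)
Lemma candidate_ok m : table_in tab M m -> seed_in m ->
  let m' := run (candidate (size xs)) m in
  (m' 11 0 != 0) = 
    [&& [forall i : 'I_n, m' 6 i < n], [forall i : 'I_n, m' 7 i < n],
        [forall i : 'I_n, m' 8 i < n], [forall i : 'I_n, m' 16 (m' 8 i) == i],
        [forall i : 'I_n, forall j : 'I_n, m tab (m 2 (m' 6 i) + m' 7 j) == m' 8 (M i j)],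
        m' 6 r == m (f 0) 0, m' 6 s == m (f 1) 0
      & [forall l : 'I_(size xs), m' 8 (nth r xs l) == m (f l.+2) 0]].
Proof.
move=> tm sm m'; rewrite /m' candidateE {m'}; set m1 := run (candidate_prefix _) m.
have w1 := @writes_candidate_prefix (size xs).
have t1 : table_in tab M m1 by apply: table_in_run.
have s1 : seed_in m1 by apply: holds_run => // l; apply: seed_var_gt.
have [wt ->] := tests_checks t1 s1; last by [].
have e11 : m1 11 0 = 1 by [].
have same a : ~~ (10 < a < 14) -> run (checks (size xs)) m1 a = m1 a.
  by move=> na; apply: run_other; apply: contra na; apply: wt.
have fn l : ~~ (5 < f l < 20) by have := f_gt l; lia.
have base a : ~~ (5 < a < 20) -> m1 a = m a by apply: run_same.
have n2 : ~~ (5 < 2 < 20) by [].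
have nt : ~~ (5 < tab < 20) by lia.
rewrite e11 andTb !(same 6) // !(same 7) // !(same 8) // (same 16) //.
rewrite (base 2) // (base tab) // (base (f 0)) // (base (f 1)) //.
by do 7 congr andb; apply: eq_forallb => l; rewrite (base (f l.+2)).
Qed.

(** The checks alone yield an autotopism, however arrays 6, 7 and 8 were obtained. *)
Lemma candidate_sound m : table_in tab M m -> seed_in m ->
  let m' := run (candidate (size xs)) m in m' 11 0 != 0 ->
  exists2 Theta, Theta \in autotopy M &
    [/\ forall i : 'I_n, m' 6 i = Theta.1.1 i, forall j : 'I_n, m' 7 j = Theta.1.2 j,
        forall w : 'I_n, m' 8 w = Theta.2 w
      & holds m f (map val (seed_image Theta r s xs))].
Proof.
move=> tm sm m'; rewrite candidate_ok // -/m'.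
case/and5P => /forallP lt6 /forallP lt7 /forallP lt8 /forallP inv8.
case/and4P => /'forall_forallP hom /eqP er /eqP es /forallP exs.
pose alpha i := Ordinal (lt6 i); pose beta i := Ordinal (lt7 i).
pose gamma i := Ordinal (lt8 i).
have homE i j : M (alpha i) (beta j) = gamma (M i j).
  by apply: val_inj => /=; have /eqP <- := hom i j; case: tm => _ /(_ (alpha i) (beta j)).
have injc : injective gamma.
  move=> w w' /(congr1 val) /= e; apply: val_inj.
  by rewrite /= -(eqP (inv8 w)) e (eqP (inv8 w')).
(* Two rows with the same image would have, by [homE], the same gamma-value in column [r]. *)
have inja : injective alpha.
  move=> i i' e; apply: (@col_injective _ M r); apply: injc.
  by rewrite -!homE e.
have injb : injective beta.
  move=> j j' e; apply: (@row_injective _ M r); apply: injc.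
  by rewrite -!homE e.
exists (perm inja, perm injb, perm injc).
  by apply/autotopyP => i j /=; rewrite !permE homE.
split=> [i|j|w|]; rewrite ?permE //.
move=> [|[|l]] /=; rewrite ?permE // size_map => lt.
rewrite size_map in lt; rewrite -map_comp (nth_map r) //= permE /=.
by have /eqP <- := exs (Ordinal (lt : l < size xs)).
Qed.

(** * Candidates built from the image of a seed under an autotopism *)

Section Complete.

Variable Theta : isotopism n.
Hypothesis autT : Theta \in autotopy M.

Let target m := holds m f (map val (seed_image Theta r s xs)).

Lemma eval_entry m (i j : 'I_n) e1 e2 : table_in tab M m ->
  eval m e1 = i -> eval m e2 = j -> eval m (entry tab e1 e2) = M i j.
Proof. by move=> [_ tM] /= -> ->. Qed.

Lemma fill_table a e1 e2 m (F G : 'I_n -> nat) :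
    5 < a < 20 -> a != 12 -> table_in tab M m ->
    (forall (j : 'I_n) (m1 : memory), eval m1 (var 12) = j ->
       (forall b, b != 12 -> b != a -> m1 b = m b) ->
       (forall b, ~~ (5 < b < 20) -> m1 b = m b) -> table_in tab M m1 ->
       eval m1 e1 = F j /\ eval m1 e2 = G j) ->
    injective F ->
  forall j, run (LFor 12 (LStore a e1 e2)) m a (F j) = G j.
Proof.
move=> ha a12 tm he injF; apply: run_fill => //; first by case: tm.
move=> j m1 ej same; have same' b : ~~ (5 < b < 20) -> m1 b = m b.
  by move=> hb; apply: same; lia.
by apply: he => //; apply: table_in_eq tm; apply: same'; lia.
Qed.

Lemma run_setup m : table_in tab M m -> seed_in m -> target m ->
  [/\ forall w : 'I_n, run setup m 8 w = n,
      forall w : 'I_n, run setup m 9 w = row_relative M r s w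
    & forall w : 'I_n, run setup m 10 w =
        row_relative M (Theta.1.1 r) (Theta.1.1 s) w].
Proof.
move=> tm sm fm.
have er : m (seed_var 0) 0 = r by apply: sm 0 _.
have es : m (seed_var 1) 0 = s by apply: sm 1 _.
have ea : m (f 0) 0 = Theta.1.1 r by apply: fm 0 _.
have eb : m (f 1) 0 = Theta.1.1 s by apply: fm 1 _.
have fn l : ~~ (5 < f l < 20) by have := f_gt l; lia.
have sn l : ~~ (5 < seed_var l < 20) by have := seed_var_gt l; lia.
rewrite /setup /block [foldr _ _ _]/=.
set c1 := LFor _ _; set c2 := LFor _ _; set c3 := LFor _ _.
change (run (LSeq c1 _) m) with (run c3 (run c2 (run c1 m))).
set m1 := run c1 m; set m2 := run c2 m1.
have w1 a : writes c1 a -> 5 < a < 20 by rewrite /=; lia.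
have w2 a : writes c2 a -> 5 < a < 20 by rewrite /=; lia.
have same1 a : ~~ (5 < a < 20) -> m1 a = m a by apply: run_same.
have same2 a : ~~ (5 < a < 20) -> m2 a = m a.
  by move=> ha; rewrite /m2 (run_same m1 w2) ?same1.
have t1 : table_in tab M m1 by apply: table_in_run.
have t2 : table_in tab M m2 by apply: table_in_run.
split=> w.
- rewrite (@run_other c3) // /m2 (@run_other c2) //.
  apply: (fill_table (F := fun w : 'I_n => w) (G := fun=> n)) => //; last exact: val_inj.
  by move=> j m3 ej _ _ [en _]; rewrite ej /= en.
(* Array 9 is filled column by column, so the symbol [w] is located through its column [j] in row
   [r]. *)
- rewrite (@run_other _ _ 9) //; have [j ->] := row_onto M r w.
  rewrite row_relativeE.
  apply: (fill_table (F := fun j => M r j) (G := fun j => M s j)) => //; last first.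
    by move=> j1 j2 /val_inj /row_injective.
  move=> j1 m3 ej _ same3 t3.
  by split; apply: eval_entry => //=; rewrite same3 ?same1.
- have [j ->] := row_onto M (Theta.1.1 r) w; rewrite row_relativeE.
  apply: (fill_table (F := fun j => M (Theta.1.1 r) j)
                     (G := fun j => M (Theta.1.1 s) j)) => //; last first.
    by move=> j1 j2 /val_inj /row_injective.
  move=> j1 m3 ej _ same3 t3.
  by split; apply: eval_entry => //=; rewrite same3 ?same2.
Qed.

Lemma run_walks m (p q : 'S_n) :
    p = row_relative M r s -> q = row_relative M (Theta.1.1 r) (Theta.1.1 s) ->
    table_in tab M m -> seed_in m -> target m ->
    (forall w : 'I_n, m 8 w = n) -> (forall w : 'I_n, m 9 w = p w) ->
    (forall w : 'I_n, m 10 w = q w) ->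
  forall w : 'I_n, run (walks (size xs)) m 8 w =
    if reached M r s xs w then val (Theta.2 w) else n.
Proof.
move=> ep eq [mn mM] sm fm m8 m9 m10.
have fn l : ~~ (5 < f l < 20) by have := f_gt l; lia.
have sn l : ~~ (5 < seed_var l < 20) by have := seed_var_gt l; lia.
(* After [k] walks, gamma is known exactly on the cycles of the first [k] symbols. *)
suff H k : k <= size xs -> forall w : 'I_n, run (walks k) m 8 w =
    if reached M r s (take k xs) w then val (Theta.2 w) else n.
  by move=> w; rewrite H // take_size.
elim: k => [|k IHk] ltk w; first by rewrite take0 [LHS]m8.
have -> : run (walks k.+1) m 8 = run (walk (seed_var k.+2) (f k.+2)) (run (walks k) m) 8.
  by rewrite {1}/walks -{1}[k.+1]addn1 iotaD map_cat run_block_cat.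
have wk a : writes (walks k) a -> a \in [:: 8; 12; 14; 15].
  by rewrite writes_block has_map => /hasP[l _] /=; rewrite !inE; lia.
have keep a : a \notin [:: 8; 12; 14; 15] -> run (walks k) m a = m a.
  by move=> na; apply: run_other; apply: contra na; apply: wk.
have keep' a : ~~ (5 < a < 20) -> run (walks k) m a = m a.
  by move=> na; apply: keep; rewrite !inE; lia.
rewrite (@run_walk n p q Theta.2 _ _ (nth r xs k) (reached M r s (take k xs))) //.
- by rewrite (take_nth r) // /reached has_rcons -ep.
- by rewrite keep'.
- by move=> w'; rewrite keep // m9.
- by move=> w'; rewrite keep // m10.
- by move=> w'; rewrite ep eq row_relative_autotopy.
- by rewrite keep' // sm /= ?size_map // (nth_map r).
- by rewrite keep' // fm /= ?size_map // -map_comp (nth_map r).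
- exact: IHk (ltnW ltk).
Qed.

Lemma run_complete m : table_in tab M m -> seed_in m -> target m ->
    (forall w : 'I_n, m 8 w = Theta.2 w) ->
  [/\ forall i : 'I_n, run complete m 6 i = Theta.1.1 i,
      forall j : 'I_n, run complete m 7 j = Theta.1.2 j
    & forall w : 'I_n, run complete m 16 (Theta.2 w) = w].
Proof.
move=> tm sm fm m8.
have /autotopyP hom := autT.
have er : m (seed_var 0) 0 = r by apply: sm 0 _.
have ea : m (f 0) 0 = Theta.1.1 r by apply: fm 0 _.
have fn l : ~~ (5 < f l < 20) by have := f_gt l; lia.
have sn l : ~~ (5 < seed_var l < 20) by have := seed_var_gt l; lia.
have n0 : 0 < n by apply: leq_trans (ltn_ord r).
pose o := Ordinal n0.
rewrite /complete /block [foldr _ _ _]/=.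
set c1 := LFor _ _; set c2 := LFor _ _; set c3 := LFor _ _.
set c4 := LFor _ _; set c5 := LFor _ _.
change (run (LSeq c1 _) m) with (run c5 (run c4 (run c3 (run c2 (run c1 m))))).
set m1 := run c1 m; set m2 := run c2 m1; set m3 := run c3 m2; set m4 := run c4 m3.
have t1 : table_in tab M m1 by apply: table_in_run tm => a /=; lia.
have t2 : table_in tab M m2 by apply: table_in_run t1 => a /=; lia.
have t3 : table_in tab M m3 by apply: table_in_run t2 => a /=; lia.
have t4 : table_in tab M m4 by apply: table_in_run t3 => a /=; lia.
have same1 a : a != 12 -> a != 16 -> m1 a = m a.
  by move=> a1 a2; apply: run_other => /=; rewrite negb_or a1.
have W1 j : m1 16 (M (Theta.1.1 r) j) = j.
  apply: (fill_table (F := fun j => M (Theta.1.1 r) j) (G := fun j => j)) => //.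
    move=> j' m' ej _ same t; split=> //; apply: eval_entry => //=.
    by rewrite same.
  by move=> j1 j2 /val_inj /row_injective.
have B (j : 'I_n) : m2 7 j = Theta.1.2 j.
  apply: (fill_table (F := fun j => j) (G := fun j => Theta.1.2 j)) => //; last exact: val_inj.
  move=> j' m' ej same same' t; split=> //.
  rewrite -[eval _ _]/(m' 16 (m' 8 (eval m' (entry tab (var (seed_var 0)) (var 12))))).
  rewrite (eval_entry (i := r) (j := j') t) //=; last by rewrite same' ?same1 //; lia.
  by rewrite !same // (same1 8) // m8 -hom W1.
have W3 i : m3 16 (M i (Theta.1.2 o)) = i.
  apply: (fill_table (F := fun i => M i (Theta.1.2 o)) (G := fun i => i)) => //.
    move=> i' m' ei same _ t; split=> //; apply: eval_entry => //=.
    by rewrite same // (B o).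
  by move=> i1 i2 /val_inj /col_injective.
have m28 : m2 8 = m 8 by rewrite /m2 run_other // same1.
have A (i : 'I_n) : m4 6 i = Theta.1.1 i.
  apply: (fill_table (F := fun i => i) (G := fun i => Theta.1.1 i)) => //; last exact: val_inj.
  move=> i' m' ei same same' t; split=> //.
  rewrite -[eval _ _]/(m' 16 (m' 8 (eval m' (entry tab (var 12) (Const 0))))).
  rewrite (eval_entry (i := i') (j := o) t) //=.
  by rewrite !same // [m3 8](@run_other c3) // m28 m8 -hom W3.
split=> [i|j|w].
- by rewrite (@run_other c5).
- by rewrite (@run_other c5) // /m4 (@run_other c4) // /m3 (@run_other c3) // B.
apply: (fill_table (F := fun w => Theta.2 w) (G := fun w => w)) => //.
  move=> j m' ej same _ _; split=> //=.
  rewrite -[m' 12 0]/(eval m' (var 12)) ej same //.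
  by rewrite /m4 (@run_other c4) // /m3 (@run_other c3) // m28 m8.
by move=> w1 w2 /val_inj /perm_inj.
Qed.

(** A symbol missed by the walks keeps the value n and fails the range test. When none is missed,
    gamma is the one of [Theta], beta and alpha follow, and all the tests pass. *)
Lemma candidate_complete m : table_in tab M m -> seed_in m -> target m ->
  (run (candidate (size xs)) m 11 0 != 0) = [forall w, reached M r s xs w].
Proof.
move=> tm sm fm; rewrite candidate_ok //; set m' := run _ m.
have [e8 e9 e10] := run_setup tm sm fm.
pose m1 := run setup m; pose m2 := run (walks (size xs)) m1.
pose m3 := run complete m2.
have ws := writes_setup; have ww := @writes_walks (size xs).
have t1 : table_in tab M m1 by apply: table_in_run.
have s1 : seed_in m1 by apply: holds_run => //; apply: seed_var_gt.
have f1 : target m1 by apply: holds_run.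
have C := run_walks erefl erefl t1 s1 f1 e8 e9 e10.
have t2 : table_in tab M m2 by apply: table_in_run.
have s2 : seed_in m2 by apply: holds_run => //; apply: seed_var_gt.
have f2 : target m2 by apply: holds_run.
have m'E : m' = run (checks (size xs)) (update m3 11 0 1) by [].
have same a : ~~ (10 < a < 14) -> m' a = m3 a.
  move=> na; rewrite m'E run_other; last by apply: contra na; apply: writes_checks.
  by apply: update_other; lia.
have m'8 w : m' 8 (val w) = if reached M r s xs w then val (Theta.2 w) else n.
  by rewrite same // /m3 run_other //; apply: C.
have [/forallP all_reached|] := boolP [forall w, reached M r s xs w]; last first.
  rewrite negb_forall => /existsP[w nw]; apply/negP => /and5P[_ _ /forallP/(_ w)].
  by rewrite m'8 (negbTE nw) ltnn.
have e8' (w : 'I_n) : m2 8 w = Theta.2 w by rewrite [LHS]C all_reached.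
have m'8E (w : 'I_n) : m' 8 w = Theta.2 w by rewrite m'8 all_reached.
have [A B W] := run_complete t2 s2 f2 e8'.
have A' (i : 'I_n) : m' 6 i = Theta.1.1 i by rewrite same.
have B' (i : 'I_n) : m' 7 i = Theta.1.2 i by rewrite same.
have /autotopyP hom := autT; case: tm => _ tm.
apply/and5P; split; try (by apply/forallP => i; rewrite ?A' ?B' ?m'8E).
  by apply/forallP => i; rewrite m'8E same //; apply/eqP/W.
apply/and4P; split.
- by apply/'forall_forallP => i j; rewrite A' B' m'8E tm hom.
- by rewrite A' (fm 0).
- by rewrite A' (fm 1).
- apply/forallP => l; rewrite m'8E fm /= ?size_map ?ltnS //.
  by rewrite (nth_map r) ?size_map // (nth_map r).
Qed.

End Complete.
End Instance.
End Candidate.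

(** * Enumeration and output *)

Fixpoint tuples (n k : nat) : seq (seq nat) :=
  if k is k'.+1 then [seq x :: t | x <- iota 0 n, t <- tuples n k'] else [:: [::]].

Lemma mem_tuples n k t : (t \in tuples n k) = (size t == k) && all (fun x => x < n) t.
Proof.
elim: k t => [|k IH] [|x t] //=; first by apply/allpairsP => -[[y u] []].
apply/allpairsP/idP => [[[y u] /= [hy hu [-> ->]]]|/and3P[sz ltx lt]].
  by move: hu hy; rewrite IH mem_iota eqSS => /andP[-> ->]; rewrite leq0n add0n /= => ->.
by exists (x, t); rewrite IH mem_iota -eqSS sz ltx lt.
Qed.

Lemma tuples_uniq n k : uniq (tuples n k).
Proof.
elim: k => //= k IH; apply: allpairs_uniq => //; first exact: iota_uniq.
by move=> [x t] [y u] _ _ /= [-> ->].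
Qed.

Definition nest (vs : seq nat) (body : lcmd) : lcmd := foldr LFor body vs.

Lemma writes_nest vs body a : writes (nest vs body) a = (a \in vs) || writes body a.
Proof. by elim: vs => //= v vs ->; rewrite inE orbA. Qed.

Lemma well_formed_nest vs body : uniq vs -> all (fun v => ~~ writes body v) vs ->
  well_formed body -> well_formed (nest vs body).
Proof.
elim: vs => //= v vs IH /andP[nv uvs] /andP[wv wvs] wf.
by rewrite writes_nest negb_or nv wv IH.
Qed.

(** [Inv] is indexed by the list of tuples already treated, and must survive any change of the loop
    counters. *)
Lemma nest_rule vs body (Inv : seq (seq nat) -> memory -> Prop) S m :
    uniq vs -> all (fun v => ~~ writes body v) vs -> 0 \notin vs -> ~~ writes body 0 ->
    (forall S v x m1, v \in vs -> Inv S m1 -> Inv S (update m1 v 0 x)) ->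
    (forall S t m1, t \in tuples (m 0 0) (size vs) ->
       (forall l, l < size vs -> m1 (nth 0 vs l) 0 = nth 0 t l) ->
       (forall a, a \notin vs -> ~~ writes body a -> m1 a = m a) ->
       Inv S m1 -> Inv (rcons S t) (run body m1)) ->
  Inv S m -> Inv (S ++ tuples (m 0 0) (size vs)) (run (nest vs body) m).
Proof.
elim: vs Inv S m => [|v vs IH] Inv S m.
  by move=> _ _ _ _ _ step inv; rewrite cats1; apply: step.
rewrite /= inE negb_or => /andP[nv uvs] /andP[wv wvs] /andP[v0 n0] wb stable step inv.
have cv : ~~ writes (nest vs body) v by rewrite writes_nest negb_or nv.
have := @for_rule v (nest vs body) cv m (fun j m1 =>
  Inv (S ++ [seq x :: t | x <- iota 0 j, t <- tuples (m 0 0) (size vs)]) m1).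
apply; first by rewrite cats0; apply: stable; rewrite ?mem_head.
move=> j m1 ltj ej same inv1; apply: (stable); first exact: mem_head.
rewrite -addn1 iotaD allpairs_cat allpairs1l /= catA.
set S1 := S ++ _ in inv1 *.
have m10 : m1 0 0 = m 0 0 by rewrite same // writes_nest negb_or n0.
(* The inner loops restart from the empty list, and their invariant puts the current outer value [j]
   in front of each tuple. *)
have := IH (fun S' => Inv (S1 ++ map (cons j) S')) [::] m1; rewrite m10.
apply=> //; last by rewrite cats0.
- by move=> S' v' x m2 hv'; apply: stable; rewrite inE hv' orbT.
- move=> S' t m2 ht vals same2; rewrite map_rcons -rcons_cat; apply: step.
  + by apply: allpairs_f => //; rewrite mem_iota.
  + by move=> [|l] lt /=; rewrite ?vals // same2.
  + move=> a; rewrite inE negb_or => /andP[av avs] wa.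
    by rewrite same2 // same // writes_nest negb_or avs.
Qed.

(** * Writing autotopisms to the output *)

Definition emit_perm (a : nat) : lcmd := block
  [:: LFor 12 (LStore 1 (Add (var 4) (var 12)) (Cell a (var 12)));
      LStore 4 (Const 0) (Add (var 4) (var 0))].

(* Output cell 0 is reserved for the number of autotopisms. *)
Definition written (m : memory) (w : seq nat) : Prop :=
  m 4 0 = (size w).+1 /\ forall i, i < size w -> m 1 i.+1 = nth 0 w i.

Lemma run_emit_perm a n (s : 'S_n) w m :
    5 < a -> a != 12 -> m 0 0 = n -> (forall i : 'I_n, m a i = s i) ->
    written m w ->
  written (run (emit_perm a) m) (w ++ encode_perm s) /\
  run (emit_perm a) m 1 0 = m 1 0.
Proof.
move=> a5 a12 mn ms [free prev].
have size_s : size (encode_perm s) = n by rewrite size_map size_enum_ord.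
set c := LFor 12 (LStore 1 (Add (var 4) (var 12)) (Cell a (var 12))).
have -> : run (emit_perm a) m =
    update (run c m) 4 0 (run c m 4 0 + run c m 0 0) by [].
rewrite !(@run_other c) // mn free.
(* The bound includes [size w], as the earlier output occupies cells 1 to [size w], after the
   counter in cell 0. *)
have H : forall i, run c m 1 i = if i <= size w then m 1 i
    else if i < (size w).+1 + n then nth 0 (encode_perm s) (i - (size w).+1) else m 1 i.
  have := @for_rule 12 (LStore 1 (Add (var 4) (var 12)) (Cell a (var 12))) isT m
   (fun t m1 => forall i, m1 1 i = if i <= size w then m 1 i
    else if i < (size w).+1 + t then nth 0 (encode_perm s) (i - (size w).+1) else m 1 i).
  rewrite mn; apply.
    move=> i; rewrite update_other // addn0 ltnS.
    by case: leqP.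
  move=> t m1 ltn et same IH i; rewrite update_other //.
  rewrite -[run _ m1]/(update m1 1 (m1 4 0 + m1 12 0) (m1 a (m1 12 0))) et.
  rewrite (same 4) // free (same a) //=; last by lia.
  have [->|ne] := eqVneq i ((size w).+1 + t).
    have -> : ((size w).+1 + t <= size w) = false by lia.
    have -> : (size w).+1 + t < (size w).+1 + t.+1 by lia.
    rewrite update_same addKn (nth_map (Ordinal ltn)) ?size_enum_ord //.
    rewrite (ms (Ordinal ltn)); congr (val (s _)); apply: val_inj.
    by rewrite /= nth_enum_ord.
  rewrite update_cell // IH; case: (leqP i (size w)) => // _.
  by have -> : (i < (size w).+1 + t.+1) = (i < (size w).+1 + t) by lia.
split; last by rewrite update_other // H.
split; first by rewrite update_same size_cat size_s addSn.
move=> i; rewrite size_cat size_s update_other // H nth_cat => lt.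
case: ltnP => h; first by rewrite prev.
have -> : i.+1 < (size w).+1 + n by lia.
by rewrite subSS.
Qed.

Section Emit.

(* The search runs on L, and on its transpose when tr is true; in the latter
   case rows and columns are exchanged back in the output. *)
Variable tr : bool.

Definition orient n (Theta : isotopism n) := if tr then swap Theta else Theta.

Definition emit : lcmd := block
  [:: emit_perm (if tr then 7 else 6); emit_perm (if tr then 6 else 7); emit_perm 8;
      LStore 1 (Const 0) (Add (var 1) (Const 1))].

Definition printed n (m : memory) (l : seq (isotopism n)) : Prop :=
  m 1 0 = size l /\ written m (flatten [seq encode_isotopism (orient Theta) | Theta <- l]).

Lemma printed_eq n m m' (l : seq (isotopism n)) :
  m' 1 = m 1 -> m' 4 = m 4 -> printed m l -> printed m' l.
Proof. by rewrite /printed /written => -> ->. Qed.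

Lemma writes_emit a : writes emit a -> a \in [:: 1; 4; 12].
Proof. by rewrite /= !inE; lia. Qed.

Lemma run_emit n (Theta : isotopism n) l m : m 0 0 = n ->
    (forall i : 'I_n, m 6 i = Theta.1.1 i) -> (forall i : 'I_n, m 7 i = Theta.1.2 i) ->
    (forall i : 'I_n, m 8 i = Theta.2 i) -> printed m l ->
  printed (run emit m) (rcons l Theta).
Proof.
move=> mn m6 m7 m8 [count wr].
pose a := if tr then 7 else 6; pose b := if tr then 6 else 7.
have [ha hb] : [/\ 5 < a, a != 12, 5 < b & b != 12] /\ True by rewrite /a /b; case: tr.
have {ha} [a5 a12 b5 b12] := ha.
pose m1 := run (emit_perm a) m; pose m2 := run (emit_perm b) m1.
pose m3 := run (emit_perm 8) m2.
have keep c m' d : 4 < d -> d != 12 -> run (emit_perm c) m' d = m' d.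
  by move=> d4 d12; apply: run_other => /=; lia.
have keep0 c m' : run (emit_perm c) m' 0 = m' 0 by apply: run_other.
have ma (i : 'I_n) : m a i = (orient Theta).1.1 i.
  by rewrite /a /orient; case: tr; rewrite ?m6 ?m7.
have mb (i : 'I_n) : m b i = (orient Theta).1.2 i.
  by rewrite /b /orient; case: tr; rewrite ?m6 ?m7.
have mc (i : 'I_n) : m 8 i = (orient Theta).2 i by rewrite m8 /orient; case: tr.
have [w1 c1] := run_emit_perm a5 a12 mn ma wr.
have [||w2 c2] := run_emit_perm b5 b12 _ _ w1 (s := (orient Theta).1.2).
- by rewrite keep0.
- by move=> i; rewrite keep ?mb //; lia.
have [||w3 c3] := @run_emit_perm 8 _ (orient Theta).2 _ _ isT isT _ _ w2.
- by rewrite !keep0.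
- by move=> i; rewrite !keep.
have -> : run emit m = update m3 1 0 (m3 1 0 + 1) by [].
rewrite /m3 c3 c2 c1 count; split; first by rewrite update_same size_rcons addn1.
have -> : flatten [seq encode_isotopism (orient T) | T <- rcons l Theta] =
    ((flatten [seq encode_isotopism (orient T) | T <- l] ++ encode_perm (orient Theta).1.1)
      ++ encode_perm (orient Theta).1.2) ++ encode_perm (orient Theta).2.
  rewrite map_rcons flatten_rcons -!catA; congr (_ ++ _).
  by case: (orient Theta) => [[]].
case: w3 => free out; split; first by rewrite update_other.
by move=> i lt; rewrite update_cell // out.
Qed.

End Emit.

(** * The search *)

Definition seed_vars (k : nat) := [seq seed_var l | l <- iota 0 k.+2].
Definition image_vars (k : nat) := [seq image_var l | l <- iota 0 k.+2].

Lemma image_var_gt l : 19 < image_var l.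
Proof. by rewrite /image_var; lia. Qed.

Section Search.

Variables (tr : bool) (k : nat).

Definition table : nat := if tr then 3 else 0.

Definition try_image : lcmd :=
  LSeq (candidate table image_var k) (LIf (var 11) (emit tr) LSkip).

(** Flag 5 lets only the first generating seed start an enumeration; a second one would list the
    whole group again. *)
Definition try_seed : lcmd :=
  LIf (var 5) LSkip
    (LSeq (candidate table seed_var k)
          (LIf (var 11) (LSeq (LStore 5 (Const 0) (Const 1))
                              (nest (image_vars k) try_image)) LSkip)).

Definition search : lcmd := nest (seed_vars k) try_seed.

Lemma table_lt : table < 4.
Proof. by rewrite /table; case: tr. Qed.

Lemma writes_try_image a : writes try_image a -> (a < 20) && (a \notin [:: 0; 2; 3; 5]).
Proof.
rewrite -[writes _ a]/[|| writes (candidate table image_var k) a, writes (emit tr) a | false].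
rewrite orbF => /orP[/(writes_candidate table_lt)|/writes_emit]; rewrite !inE; lia.
Qed.

Lemma writes_try_seed a : writes try_seed a ->
  (a \notin [:: 0; 2; 3]) && ((a < 20) || (a \in image_vars k)).
Proof.
rewrite -[writes _ a]/[|| writes (candidate table seed_var k) a,
  (a == 5) || writes (nest (image_vars k) try_image) a | false].
rewrite orbF writes_nest.
case/or3P => [/(writes_candidate table_lt)|/eqP->|/orP[h|/writes_try_image]].
- by rewrite !inE; lia.
- by [].
- by rewrite h orbT andbT; case/mapP: h => l _ ->; rewrite !inE /image_var; lia.
- by rewrite !inE; lia.
Qed.

Lemma seed_image_vars a : a \in seed_vars k -> a \notin image_vars k.
Proof.
by case/mapP => l _ ->; apply/mapP => -[l' _]; rewrite /seed_var /image_var; lia.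
Qed.

Lemma seed_vars_uniq : uniq (seed_vars k).
Proof. by rewrite map_inj_uniq ?iota_uniq // => l l'; rewrite /seed_var; lia. Qed.

Lemma image_vars_uniq : uniq (image_vars k).
Proof. by rewrite map_inj_uniq ?iota_uniq // => l l'; rewrite /image_var; lia. Qed.

Lemma nth_seed_vars l : l < k.+2 -> nth 0 (seed_vars k) l = seed_var l.
Proof. by move=> lt; rewrite (nth_map 0) ?size_iota // nth_iota. Qed.

Lemma nth_image_vars l : l < k.+2 -> nth 0 (image_vars k) l = image_var l.
Proof. by move=> lt; rewrite (nth_map 0) ?size_iota // nth_iota. Qed.

Lemma image_vars_safe : all (fun v => ~~ writes try_image v) (image_vars k).
Proof.
apply/allP => v /mapP[l _ ->]; apply/negP => /writes_try_image.
by have := image_var_gt l; lia.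
Qed.

Lemma seed_vars_safe : all (fun v => ~~ writes try_seed v) (seed_vars k).
Proof.
apply/allP => v hv; apply/negP => /writes_try_seed.
rewrite (negbTE (seed_image_vars hv)); case/mapP: hv => l _ ->.
by rewrite /seed_var; lia.
Qed.

Section Instance.

Variables (n : nat) (M : latin_square n).

(** * Enumeration of the images of a generating seed *)

Section Images.

Variables (r s : 'I_n) (xs : seq 'I_n).
Hypotheses (size_xs : size xs = k) (gen : generating M r s xs).

Definition image_of (Theta : isotopism n) : seq nat :=
  map val (seed_image Theta r s xs).

(** An autotopism is determined by its seed image, so a tuple adds at most one member to the list,
    and a new tuple never adds a member listed before. *)
Lemma run_try_image S t m :
    table_in table M m -> holds m seed_var (map val [:: r, s & xs]) ->
    size t = k.+2 -> holds m image_var t -> t \notin S ->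
    (exists l, [/\ uniq l, printed tr m l &
       forall Theta, (Theta \in l) = (Theta \in autotopy M) && (image_of Theta \in S)]) ->
  exists l, [/\ uniq l, printed tr (run try_image m) l &
    forall Theta, (Theta \in l) =
      (Theta \in autotopy M) && (image_of Theta \in rcons S t)].
Proof.
move=> tm sm size_t im tS [l [ul pl meml]].
pose m' := run (candidate table image_var k) m.
have -> : run try_image m = if m' 11 0 != 0 then run (emit tr) m' else m' by [].
have wc := @writes_candidate _ image_var table_lt k.
have pl' : printed tr m' l by apply: printed_eq pl; apply: run_same wc _.
have img_eq Theta : holds m image_var (image_of Theta) -> image_of Theta = t.
  move=> h; apply: (@eq_from_nth _ 0) => [|i lt].
    by rewrite size_t /= !size_map size_xs.
  by rewrite -h // im // size_t; move: lt; rewrite /= !size_map size_xs.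
have m'E : m' = run (candidate table image_var (size xs)) m by rewrite size_xs.
have [ok|fail] := boolP (m' 11 0 != 0); last first.
  exists l; split=> // Theta; rewrite meml mem_rcons in_cons andb_orr.
  have [autT|//] := boolP (Theta \in autotopy M).
  have [et|//] := eqVneq (image_of Theta) t; case/negP: fail.
  have imT : holds m image_var (image_of Theta) by rewrite et.
  rewrite m'E (candidate_complete table_lt image_var_gt autT tm sm imT).
  exact/forallP.
have := ok; rewrite m'E => /(candidate_sound table_lt image_var_gt tm sm).
rewrite -m'E => -[Theta autT [e6 e7 e8 /img_eq imT]].
exists (rcons l Theta); split.
- by rewrite rcons_uniq ul meml imT (negbTE tS) andbF.
- apply: run_emit => //; case: tm => mn _.
  by rewrite /m' (run_same m wc).
- move=> Psi; rewrite !mem_rcons !in_cons meml andb_orr; congr orb.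
  apply/eqP/andP => [->|[autP /eqP imP]]; first by rewrite imT eqxx.
  apply: (seed_image_inj gen) => //; apply: (inj_map val_inj).
  by rewrite -!/(image_of _) imP.
Qed.

Lemma run_images m :
    table_in table M m -> holds m seed_var (map val [:: r, s & xs]) ->
    printed tr m ([::] : seq (isotopism n)) ->
  exists l, [/\ uniq l, l =i autotopy M &
    printed tr (run (nest (image_vars k) try_image) m) l].
Proof.
move=> tm sm pm; have mn : m 0 0 = n by case: tm.
have size_vars : size (image_vars k) = k.+2 by rewrite size_map size_iota.
(* Assuming [uniq S] inside the invariant makes each incoming tuple new; [tuples_uniq] discharges it
   at the end. *)
have := @nest_rule (image_vars k) try_image (fun S m1 => uniq S ->
  exists l, [/\ uniq l, printed tr m1 l &
   forall Theta, (Theta \in l) = (Theta \in autotopy M) && (image_of Theta \in S)]) [::] m.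
rewrite size_vars mn => H; have {H} [||||||||l [ul pl meml]] := H.
- exact: image_vars_uniq.
- exact: image_vars_safe.
- by apply/mapP => -[l _].
- by apply/negP => /writes_try_image.
- move=> S v x m1 /mapP[l _ ->] inv uS; have [l' [ul' pl' meml']] := inv uS.
  by exists l'; split=> //; apply: printed_eq pl'; apply: update_other.
- move=> S t m1 ht vals same inv; rewrite rcons_uniq => /andP[tS uS].
  have /andP[/eqP size_t _] : (size t == k.+2) && all (fun x => x < n) t.
    by rewrite -mem_tuples.
  have keep a : a \in [:: 0; 2; 3] -> m1 a = m a.
    move=> ha; apply: same.
      by apply/mapP => -[l _ e]; move: ha; rewrite e !inE /image_var; lia.
    by apply/negP => /writes_try_image; move: ha; rewrite !inE; lia.
  apply: run_try_image => //; last exact: inv.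
  + by apply: table_in_eq tm; apply: keep; rewrite // /table; case: tr.
  + move=> l lt; rewrite same ?sm //.
      apply: seed_image_vars; apply: map_f; rewrite mem_iota /=.
      by move: lt; rewrite /= size_map size_xs.
    by apply/negP => /writes_try_image; rewrite /seed_var; lia.
  + by move=> l; rewrite size_t => lt; rewrite -nth_image_vars // vals ?size_vars.
- by move=> _; exists [::]; split=> // Theta; rewrite andbF.
- exact: tuples_uniq.
exists l; split=> // Theta; rewrite meml cat0s mem_tuples /= !size_map size_xs eqxx /=.
by rewrite andb_idr // => _; rewrite !ltn_ord; apply/allP => ? /mapP[? _ ->].
Qed.

End Images.

End Instance.

(** * Enumeration of the seeds *)

Section Listing.

Variables (n : nat) (L : latin_square n).

Definition listed (m : memory) : Prop :=
  exists w, has_output m w /\ lists_autotopisms L w.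

(** As long as no seed is found the output stays empty, so the search on the transpose can take over
    from an unsuccessful one on the square. *)
Definition pending_or_listed (m : memory) : Prop :=
  if m 5 0 == 0 then m 1 0 = 0 /\ m 4 0 = 1 else listed m.

Lemma pending_or_listed_eq m m' : m' 1 = m 1 -> m' 4 = m 4 -> m' 5 = m 5 ->
  pending_or_listed m -> pending_or_listed m'.
Proof. by rewrite /pending_or_listed /listed /has_output => -> -> ->. Qed.

Definition oriented := if tr then transpose L else L.

Lemma orient_autotopy Theta : (orient tr Theta \in autotopy L) = (Theta \in autotopy oriented).
Proof.
by rewrite /orient /oriented; case: tr; rewrite // -autotopy_transpose swapK.
Qed.

Lemma orientK : involutive (@orient tr n).
Proof. by rewrite /orient => Theta; case: tr; rewrite ?swapK. Qed.

Lemma printed_listed m l : uniq l -> l =i autotopy oriented -> printed tr m l -> listed m.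
Proof.
move=> ul meml [count [_ out]].
exists (encode_isotopisms (map (@orient tr n) l)); split; last first.
  exists (map (@orient tr n) l); split=> //.
    by rewrite map_inj_uniq //; apply: inv_inj orientK.
  move=> Theta; rewrite -[Theta in LHS]orientK mem_map ?meml; last exact: inv_inj orientK.
  by rewrite -orient_autotopy orientK.
move=> [|i] /=; first by rewrite size_map.
by rewrite ltnS -map_comp => lt; apply: out.
Qed.

(** [found] records whether the flag was up when the search began, to show that it is never lowered
    again. *)
Definition search_state (found : bool) (S : seq (seq nat)) (m : memory) : Prop :=
  pending_or_listed m /\
  (m 5 0 = 0 -> ~~ found /\ forall r s xs, size xs = k -> generating oriented r s xs ->
     map val [:: r, s & xs] \notin S).

Lemma run_try_seed found S t m : table_in table oriented m -> size t = k.+2 ->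
    all (fun x => x < n) t -> holds m seed_var t ->
  search_state found S m -> search_state found (rcons S t) (run try_seed m).
Proof.
move=> tm size_t lt_t sm [state none].
pose m1 := run (candidate table seed_var k) m.
pose m2 := run (nest (image_vars k) try_image) (update m1 5 0 1).
have -> : run try_seed m = if m 5 0 != 0 then m else if m1 11 0 != 0 then m2 else m1 by [].
have [pending|not_pending] := eqVneq (m 5 0) 0; last first.
  by rewrite /=; split=> // /eqP; rewrite (negbTE not_pending).
have wc := @writes_candidate _ seed_var table_lt k.
have keep a : ~~ (5 < a < 20) -> m1 a = m a by apply: run_same.
case: t size_t lt_t sm => [|x0 [|x1 t]] //= [size_t] /and3P[lt0 lt1 lt_t] sm.
pose r := Ordinal lt0; pose s := Ordinal lt1.
have [xs ext] : exists xs : seq 'I_n, t = map val xs.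
  elim: t lt_t {size_t sm} => [|x t IH] /=; first by exists [::].
  by case/andP=> ltx /IH[xs ->]; exists (Ordinal ltx :: xs).
rewrite {}ext size_map in size_t sm lt_t *.
have et : [:: x0, x1 & map val xs] = map val [:: r, s & xs] by [].
rewrite et in sm *.
(* The seed is its own image under the identity autotopism. *)
have ok : (m1 11 0 != 0) = [forall w, reached oriented r s xs w].
  have := @candidate_complete _ seed_var table_lt _ n oriented r s xs 1%g (group1 _) m tm sm.
  rewrite size_t; apply=> //.
  have -> // : seed_image 1%g r s xs = [:: r, s & xs].
  rewrite /seed_image /= !perm1; congr [:: _, _ & _].
  by rewrite -[RHS]map_id; apply: eq_map => x; rewrite perm1.
rewrite ok; have [/forallP gen|ngen] := boolP [forall w, reached oriented r s xs w].
  have tm1 : table_in table oriented (update m1 5 0 1).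
    apply: table_in_eq (table_in_run table_lt wc tm); apply: update_other => //.
    by rewrite /table; case: tr.
  have sm1 : holds (update m1 5 0 1) seed_var (map val [:: r, s & xs]).
    move=> l lt; rewrite update_other; last by rewrite /seed_var; lia.
    by rewrite keep ?sm // /seed_var; lia.
  have [l [ul meml pl]] : exists l, [/\ uniq l, l =i autotopy oriented & printed tr m2 l].
    apply: (run_images size_t gen tm1 sm1).
    move: state; rewrite /pending_or_listed pending eqxx => -[e1 e4].
    by split; [rewrite /= update_other // keep|split; rewrite // update_other // keep].
  have found2 : m2 5 0 = 1.
    rewrite /m2 run_other; first exact: update_same.
    rewrite writes_nest negb_or; apply/andP; split; first by apply/mapP => -[j _].
    by apply/negP => /writes_try_image.
  split; last by rewrite found2.
  by rewrite /pending_or_listed found2 /=; apply: printed_listed pl.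
split; first by apply: pending_or_listed_eq state; apply: keep.
have [nfound {}none] := none pending; move=> _; split=> // r' s' xs' size_xs' gen'.
rewrite mem_rcons in_cons negb_or none // andbT.
apply: contra ngen => /eqP /(inj_map val_inj) [er es exs].
by apply/forallP; rewrite -er -es -exs.
Qed.

Lemma run_search m : table_in table oriented m -> pending_or_listed m ->
  pending_or_listed (run search m) /\
  ((exists r s xs, size xs = k /\ generating oriented r s xs) \/ m 5 0 != 0 ->
     run search m 5 0 != 0).
Proof.
move=> tm state; have mn : m 0 0 = n by case: tm.
have size_vars : size (seed_vars k) = k.+2 by rewrite size_map size_iota.
have := @nest_rule (seed_vars k) try_seed (search_state (m 5 0 != 0)) [::] m.
rewrite size_vars mn => H; have {H} [|||||||state' none] := H.
- exact: seed_vars_uniq.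
- exact: seed_vars_safe.
- by apply/mapP => -[l _].
- by apply/negP => /writes_try_seed.
- by move=> S v x m1 /mapP[l _ ->] [].
- move=> S t m1 ht vals same; apply: run_try_seed.
  + have keep a : a \in [:: 0; 2; 3] -> m1 a = m a.
      move=> ha; apply: same.
        by apply/mapP => -[l _ e]; move: ha; rewrite e !inE /seed_var; lia.
      by apply/negP => /writes_try_seed; rewrite ha.
    by apply: table_in_eq tm; apply: keep; rewrite // /table; case: tr.
  + by move: ht; rewrite mem_tuples => /andP[/eqP].
  + by move: ht; rewrite mem_tuples => /andP[].
  + move: ht; rewrite mem_tuples => /andP[/eqP size_t _] l; rewrite size_t => lt.
    by rewrite -nth_seed_vars // vals ?size_vars.
- by split=> // ->.
split=> // hyp; apply/eqP => e; have [nfound {}none] := none e.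
case: hyp => [[r [s [xs [size_xs gen]]]]|found]; last by rewrite found in nfound.
have /negP[] := none r s xs size_xs gen.
rewrite cat0s mem_tuples /= size_map size_xs eqxx /= !ltn_ord.
by apply/allP => ? /mapP[? _ ->].
Qed.

End Listing.
End Search.

(** * The program *)

Lemma nth_allpairs (S T R : Type) (f : S -> T -> R) x0 y0 z0 s t i j :
  i < size s -> j < size t ->
  nth z0 [seq f x y | x <- s, y <- t] (i * size t + j) = f (nth x0 s i) (nth y0 t j).
Proof.
elim: s i => //= x s IH [|i] lti ltj; rewrite nth_cat size_map.
  by rewrite ltj (nth_map y0).
by rewrite mulSn -addnA ltnNge leq_addr /= addKn IH.
Qed.

Lemma nth_encode_square n (L : latin_square n) (i j : 'I_n) :
  nth 0 (encode_square L) (1 + i * n + j) = L i j.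
Proof.
have := @nth_allpairs _ _ _ (fun i j => val (L i j)) i i 0 (enum 'I_n) (enum 'I_n) i j.
by rewrite !size_enum_ord !nth_ord_enum /= => ->.
Qed.

(** Offsets are obtained by repeated addition, and start at 1 because n occupies cell 0 of the
    input. *)
Definition offsets : lcmd := block
  [:: LStore 4 (Const 0) (Const 1); LStore 2 (Const 0) (Const 1);
      LFor 12 (LStore 2 (Add (var 12) (Const 1)) (Add (Cell 2 (var 12)) (var 0)))].

Lemma run_offsets n m : m 0 0 = n ->
  run offsets m 4 0 = 1 /\ forall i, i < n -> run offsets m 2 i = 1 + i * n.
Proof.
move=> mn; pose m1 := update (update m 4 0 1) 2 0 1.
pose step := LStore 2 (Add (var 12) (Const 1)) (Add (Cell 2 (var 12)) (var 0)).
have -> : run offsets m = run (LFor 12 step) m1 by [].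
split=> [|i lti]; first by rewrite run_other.
have := @for_rule 12 step isT m1 (fun t m2 => forall i, i <= t -> m2 2 i = 1 + i * n).
have m1n : m1 0 0 = n by [].
rewrite m1n; apply=> //; last exact: ltnW; first by case.
move=> t m2 _ et same IH i' le; rewrite update_other //.
rewrite -[run _ m2]/(update m2 2 (m2 12 0 + 1) (m2 2 (m2 12 0) + m2 0 0)) et.
rewrite IH // (same 0) // m1n addn1.
have [->|ne] := eqVneq i' t.+1; first by rewrite update_same; lia.
by rewrite update_cell // IH //; lia.
Qed.

Definition transpose_table : lcmd :=
  LFor 12 (LFor 13 (LStore 3 (Add (Cell 2 (var 12)) (var 13))
                             (Cell 0 (Add (Cell 2 (var 13)) (var 12))))).

Lemma run_transpose_table n (L : latin_square n) m :
    (forall i, i < n -> m 2 i = 1 + i * n) -> table_in 0 L m ->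
  table_in 3 (transpose L) (run transpose_table m).
Proof.
move=> off [mn mL]; split; first by rewrite run_other.
move=> i j; rewrite mxE (@run_other _ _ 2) //; move: i j.
pose inner := LFor 13 (LStore 3 (Add (Cell 2 (var 12)) (var 13))
                                (Cell 0 (Add (Cell 2 (var 13)) (var 12)))).
have := @for_rule 12 inner isT m (fun t m1 => forall i j : 'I_n, i < t ->
  m1 3 (m 2 i + j) = L j i).
rewrite mn => H i j; apply: H => //.
move=> {i j} t m1 ltt et same IH i j; rewrite ltnS leq_eqVlt update_other //.
pose body := LStore 3 (Add (Cell 2 (var 12)) (var 13)) (Cell 0 (Add (Cell 2 (var 13)) (var 12))).
(* The pairs treated so far are those lexicographically before (t, u). *)
have := @for_rule 13 body isT m1 (fun u m2 => forall i j : 'I_n,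
  (i < t) || (i == t :> nat) && (j < u) -> m2 3 (m 2 i + j) = L j i).
rewrite (same 0) // mn => H lti; apply: H.
- by move=> {lti} {}i {}j; rewrite andbF orbF; apply: IH.
- move=> {lti} u m2 ltu eu same2 IH2 {}i {}j lt; rewrite update_other //.
  rewrite -[run _ m2]/(update m2 3 (m2 2 (m2 12 0) + m2 13 0) (m2 0 (m2 2 (m2 13 0) + m2 12 0))).
  rewrite eu !(same2 12) // et (same2 0) // (same2 2) // (same 0) // (same 2) //.
  rewrite (mL (Ordinal ltu) (Ordinal ltt)).
  (* Distinct pairs occupy distinct cells: quotient and remainder modulo n recover the row and the
     column. *)
  have [e|ne] := eqVneq (m 2 i + j) (m 2 t + u).
    have [ei ej] : i = t :> nat /\ j = u :> nat.
      move: e; rewrite !off ?ltn_ord // -!addnA => /addnI e.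
      have := congr1 (divn^~ n) e; have := congr1 (modn^~ n) e.
      rewrite /= !modnMDl !divnMDl ?(leq_ltn_trans _ ltt) //.
      by rewrite !modn_small // !divn_small // !addn0.
    rewrite e update_same; congr (val (L _ _)); exact: val_inj.
  rewrite update_cell // IH2 //; case/orP: lt => [->//|/andP[/eqP ei]].
  rewrite ltnS leq_eqVlt => /orP[/eqP ej|->]; last by rewrite ei eqxx orbT.
  by rewrite ei ej eqxx in ne.
- by case/orP: lti => [->|->]; rewrite ?ltn_ord ?orbT.
Qed.

Definition program (k : nat) : lcmd :=
  block [:: offsets; transpose_table; search false k; search true k].

(** The program walks exactly k symbols, so a shorter list of cycle representatives is padded with
    copies of [r], taken as a symbol. *)
Lemma generating_seed k n (L : latin_square n) (r s : 'I_n) :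
  num_cycles (row_relative L r s) <= k ->
  exists r s xs, size xs = k /\ generating L r s xs.
Proof.
have [xs [_ <- gen] lek] := cycle_representatives L r s.
exists r, s, (xs ++ nseq (k - size xs) r).
split=> [|w]; first by rewrite size_cat size_nseq subnKC.
by rewrite /reached has_cat; apply/orP; left; apply: gen.
Qed.

Lemma run_program k n (L : latin_square n) : has_few_cycles k L ->
  listed L (run (program k) (input_memory (encode_square L))).
Proof.
move=> few; set m := input_memory _.
pose m1 := run offsets m; pose m2 := run transpose_table m1.
pose m3 := run (search false k) m2.
have [free off] : m1 4 0 = 1 /\ forall i, i < n -> m1 2 i = 1 + i * n.
  exact: run_offsets.
have -> : run (program k) m = run (search true k) m3 by [].
have m10 : m1 0 = m 0 by apply: run_other.
have t1 : table_in 0 L m1.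
  by split=> [|i j]; rewrite m10 // off //; apply: nth_encode_square.
have t2 : table_in 0 L m2 by apply: table_in_eq t1; apply: run_other.
have tt2 : table_in 3 (transpose L) m2 by apply: run_transpose_table.
have s2 : pending_or_listed L m2.
  rewrite /pending_or_listed /m2 !(@run_other transpose_table) // free.
  by rewrite /m1 !(@run_other offsets).
have [s3 found3] := run_search k (tr := false) t2 s2.
have keep a : a \in [:: 0; 2; 3] -> m3 a = m2 a.
  move=> ha; apply: run_other; rewrite writes_nest negb_or; apply/andP; split.
    by apply/mapP => -[l _ e]; move: ha; rewrite e !inE /seed_var; lia.
  by apply/negP => /writes_try_seed; rewrite ha.
have tt3 : table_in 3 (transpose L) m3 by apply: table_in_eq tt2; apply: keep.
have [s4 found4] := run_search k (tr := true) tt3 s3.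
(* With few cycles between two rows, the first search raises the flag and the second keeps it;
   between two columns, the second search meets them as rows of the transpose. *)
have found : run (search true k) m3 5 0 != 0.
  apply: found4; case: few => -[r [s [_ few]]]; [right|left].
    by apply: found3; left; apply: generating_seed few.
  by apply: (@generating_seed _ _ _ r s); rewrite row_relative_transpose.
by move: s4; rewrite /pending_or_listed (negbTE found).
Qed.

Lemma program_well_formed k : well_formed (program k) && ~~ writes (program k) 0.
Proof.
have wf_candidate tab f : well_formed (candidate tab f k).
  have wf_walks : well_formed (walks f k).
    by rewrite well_formed_block all_map; apply/allP.
  have wf_checks : well_formed (checks tab f k).
    by rewrite well_formed_block all_cat all_map; apply/andP; split=> //; apply/allP.
  by apply/and5P; split; rewrite // andbT.
have wf_search tr : well_formed (search tr k).
  have wf_image : well_formed (try_image tr k).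
    by apply/and3P; split; [exact: wf_candidate|case: tr|].
  have wf_images := well_formed_nest (image_vars_uniq k) (image_vars_safe tr k) wf_image.
  apply: well_formed_nest (seed_vars_uniq k) (seed_vars_safe tr k) _.
  by apply/and3P; split; [|exact: wf_candidate|rewrite andbT].
have search0 tr : ~~ writes (search tr k) 0.
  rewrite writes_nest negb_or; apply/andP; split; first by apply/mapP => -[l _].
  by apply/negP => /writes_try_seed.
apply/andP; split; first by apply/and5P; split; do ?exact: wf_search.
rewrite -[writes _ 0]/[|| writes (search false k) 0, writes (search true k) 0 | false].
by rewrite orbF negb_or !search0.
Qed.

Theorem autotopisms_computable k : computable_in_polynomial_time
  (fun (n : nat) (L : latin_square n) => reduced L /\ has_few_cycles k L)
  encode_square lists_autotopisms.
Proof.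
exists (compile (program k)), (cost (program k)) => n L [_ few].
have /andP[wf w0] := program_well_formed k.
have [t ex le_t] := exec_run (input_memory (encode_square L)) wf w0.
have [w [out lists]] := run_program few.
by exists t, (run (program k) (input_memory (encode_square L))), w.
Qed.

Theorem theorem3 (k : nat) (hk : 0 < k) :
  (forall (n : nat) (L : latin_square n),
     reduced L -> has_few_cycles k L ->
     #|autotopy L| <= n ^ 2 * (n - 1) ^ k) /\
  computable_in_polynomial_time
    (fun (n : nat) (L : latin_square n) => reduced L /\ has_few_cycles k L)
    encode_square lists_autotopisms.
Proof.
split=> [n L _ few|]; first exact: card_autotopy_few_cycles few.
exact: autotopisms_computable.
Qed.
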